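(* Let $G\le\mathrm{O}(d)$ be finite, $m:=|G|$, $\chi:=\chi(G)$. Let $\lambda_0$ and $n\in\mathbb{N}$ satisfy $\lambda:=\frac{n}{\chi d}\ge\lambda_0>1$, and let $z_1,\ldots,z_n\in\mathbb{R}^d$ have independent standard Gaussian entries. Then there exist an absolute constant $C>0$ and $c=c(\lambda_0)>0$ such that the max filter bank $\Phi:\mathbb{R}^d/G\to\mathbb{R}^n$, $\Phi([x])=(\langle\!\langle[z_i],[x]\rangle\!\rangle)_{i=1}^n$, has distortion $$\kappa(\Phi)\le\Big(C\chi^{3/2}m\log^{1/2}(em)\Big)^{1+c\lambda^{-1/2}}$$ with probability at least $1-3e^{-d\sqrt{\lambda}}$. In fact one may take $C=4e^{3/2}$ and $c(\lambda_0)=2+\frac{\sqrt{\lambda_0}+2}{\lambda_0-1}$.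
   Context: For $x\in\mathbb{R}^d$, $[x]:=\{gx:g\in G\}$; $d([x],[y]):=\min_{p\in[x],q\in[y]}\|p-q\|$; $\langle\!\langle[x],[y]\rangle\!\rangle:=\max_{p\in[x],q\in[y]}\langle p,q\rangle$. The open Voronoi cell $V_x$ is the set of $y$ such that $x$ is the unique maximizer of $\langle p,y\rangle$ over $p\in[x]$. $P(G):=\{x:\mathrm{stab}_G(x)=\{\mathrm{id}\}\}$, $S(x,y):=\{q\in[y]:V_q\cap V_x\ne\varnothing\}$, and $\chi(G):=\max_{x,y\in P(G)}|S(x,y)|$. For a map $f:\mathbb{R}^d/G\to\mathbb{R}^n$, let $\alpha,\beta\in[0,\infty]$ be the largest and smallest constants with $\alpha\,d([x],[y])\le\|f([x])-f([y])\|\le\beta\,d([x],[y])$ for all $x,y$; the distortion is $\kappa(f):=\beta/\alpha$, with $\kappa(f)=\infty$ if $\alpha=0$ or $\beta=\infty$. *)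

(* Defs.v *)
From HB Require Import structures.
From mathcomp Require Import all_boot all_order all_algebra.
From mathcomp Require Import all_classical all_reals all_analysis.
From mathcomp Require Import normal_distribution.

Set Implicit Arguments.
Unset Strict Implicit.
Unset Printing Implicit Defensive.

Import Order.TTheory GRing.Theory Num.Theory.
Import numFieldNormedType.Exports.

Local Open Scope classical_set_scope.
Local Open Scope ring_scope.

Section MaxFilter.
Variable R : realType.

Definition inner (d : nat) (p q : 'cV[R]_d) : R := \sum_(i < d) p i 0 * q i 0.

Definition enorm (d : nat) (v : 'cV[R]_d) : R := Num.sqrt (\sum_(i < d) v i 0 ^+ 2).

(* G is a finite subgroup of O(d), listed without repetition as a sequence of
   matrices.  (A finite subset of GL(d) containing 1 and closed under products
   is a group.) *)
Definition is_fin_orth_group (d : nat) (G : seq 'M[R]_d) : Prop :=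
  [/\ uniq G, 1%:M \in G,
      (forall g h, g \in G -> h \in G -> g *m h \in G) &
      (forall g, g \in G -> g *m g^T = 1%:M)].

Definition orbit (d : nat) (G : seq 'M[R]_d) (x : 'cV[R]_d) : seq 'cV[R]_d :=
  [seq g *m x | g <- G].

(* d([x],[y]) = min_{p in [x], q in [y]} ||p - q||
   (the seed value ||x - y|| is itself attained since 1 \in G) *)
Definition orbit_dist (d : nat) (G : seq 'M[R]_d) (x y : 'cV[R]_d) : R :=
  \big[Num.min/enorm (x - y)]_(g <- G)
    \big[Num.min/enorm (x - y)]_(h <- G) enorm (g *m x - h *m y).

(* <<[x],[y]>> = max_{p in [x], q in [y]} <p, q>
   (the seed value <x, y> is itself attained since 1 \in G) *)
Definition maxfilter (d : nat) (G : seq 'M[R]_d) (x y : 'cV[R]_d) : R :=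
  \big[Num.max/inner x y]_(g <- G)
    \big[Num.max/inner x y]_(h <- G) inner (g *m x) (h *m y).

Definition voronoi (d : nat) (G : seq 'M[R]_d) (x y : 'cV[R]_d) : Prop :=
  forall p, p \in orbit G x -> p != x -> inner p y < inner x y.

Definition principal (d : nat) (G : seq 'M[R]_d) (x : 'cV[R]_d) : Prop :=
  forall g, g \in G -> g *m x = x -> g = 1%:M.

Definition Sxy (d : nat) (G : seq 'M[R]_d) (x y : 'cV[R]_d) : seq 'cV[R]_d :=
  [seq q <- undup (orbit G y) |
     `[< exists w : 'cV[R]_d, voronoi G q w /\ voronoi G x w >]].

(* chi(G) = max_{x,y in P(G)} |S(x,y)|; since |S(x,y)| <= |G|, the max can be
   taken over k <= |G|. *)
Definition chiG (d : nat) (G : seq 'M[R]_d) : nat :=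
  \big[maxn/0%N]_(k < (size G).+1 |
     `[< exists x y : 'cV[R]_d,
           [/\ principal G x, principal G y & size (Sxy G x y) = val k] >])
    val k.

Definition filter_bank (d n : nat) (G : seq 'M[R]_d) (z : 'I_n -> 'cV[R]_d)
  (x : 'cV[R]_d) : 'cV[R]_n :=
  \col_(i < n) maxfilter G (z i) x.

(* Distortion of a map f : R^d/G -> R^n, given as a G-invariant function on
   R^d.  alpha = largest (in [0,oo]) constant with alpha d([x],[y]) <= ||f x - f y||,
   beta = smallest (in [0,oo]) constant with ||f x - f y|| <= beta d([x],[y]). *)
Definition lower_lip (d n : nat) (G : seq 'M[R]_d) (f : 'cV[R]_d -> 'cV[R]_n)
  (a : R) : Prop :=
  forall x y, a * orbit_dist G x y <= enorm (f x - f y).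

Definition upper_lip (d n : nat) (G : seq 'M[R]_d) (f : 'cV[R]_d -> 'cV[R]_n)
  (b : R) : Prop :=
  forall x y, enorm (f x - f y) <= b * orbit_dist G x y.

Definition lip_alpha (d n : nat) (G : seq 'M[R]_d) (f : 'cV[R]_d -> 'cV[R]_n)
  : \bar R :=
  ereal_sup [set a%:E | a in [set a : R | 0 <= a /\ lower_lip G f a]].

Definition lip_beta (d n : nat) (G : seq 'M[R]_d) (f : 'cV[R]_d -> 'cV[R]_n)
  : \bar R :=
  ereal_inf [set b%:E | b in [set b : R | 0 <= b /\ upper_lip G f b]].

Definition distortion (d n : nat) (G : seq 'M[R]_d) (f : 'cV[R]_d -> 'cV[R]_n)
  : \bar R :=
  let a := lip_alpha G f in
  let b := lip_beta G f in
  if (a == 0%E) || (b == +oo%E) then +oo%E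
  else if a == +oo%E then 0%E
  else (fine b / fine a)%:E.

End MaxFilter.

(* Mutual independence of a finite family of real random variables Z i j:
   the joint law of (Z i j)_{i,j} is the product of the marginals
   (taking B i j = setT recovers every subfamily). *)
Definition mutually_independent (R : realType) (dT : measure_display)
  (T : measurableType dT) (P : probability T R) (n d : nat)
  (Z : 'I_n -> 'I_d -> {RV P >-> R}) : Prop :=
  forall B : 'I_n -> 'I_d -> set R,
    (forall i j, measurable (B i j)) ->
    P [set w | forall i j, B i j (Z i j w)] =
    (\prod_(i < n) \prod_(j < d) P (Z i j @^-1` B i j))%E.

Definition std_gaussian (R : realType) (dT : measure_display)
  (T : measurableType dT) (P : probability T R) (X : {RV P >-> R}) : Prop :=
  forall A : set R, measurable A -> P (X @^-1` A) = normal_prob 0 1 A.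

(* Main.v *)
Require Import Defs.
From HB Require Import structures.
From mathcomp Require Import all_boot all_order all_algebra.
From mathcomp Require Import all_classical all_reals all_analysis.
From mathcomp Require Import normal_distribution measurable_realfun ring lra.

(* For principal [x], [y], a template [z_i] in general position lies in some
   [V_p] and some [V_q] with [p] in [[x]], [q] in [[y]].  Moving [p] to [x] by a
   group element turns the difference of the i-th filters into
   [<g_i z_i, x - w_i>] with [w_i] in [S(x,y)], so by pigeonhole a single [w]
   serves at least [k = ceil(n / chi)] indices.  Hence the lower Lipschitz
   constant is at least the least singular value of all matrices with rows
   [g_i z_i], [i] in [I], [#|I| = k]; likewise the upper constant is at most the
   largest singular value of all matrices with rows [g_i z_i], [i < n].  Both are
   controlled by a union bound over [g], [I] and a grid net of the sphere, using
   Chernoff bounds for chi-square variables.  Choosing the lower threshold so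
   that the ratio of the two bounds is exactly the claimed distortion leaves an
   inequality between exponents.  General [x], [y] follow by density of the
   principal points. *)

Set Implicit Arguments.
Unset Strict Implicit.
Unset Printing Implicit Defensive.
Import Order.TTheory GRing.Theory Num.Theory.
Import numFieldNormedType.Exports.
Local Open Scope classical_set_scope.
Local Open Scope ring_scope.

(** * Gaussian integrals and independence *)

(** Write [x] for [lambda^(-1/2)] and [kappa] for the claimed distortion. General position costs no
    probability: each template is perturbed, and since an orbit is finite, a maximizer found for a
    close enough perturbation is already a maximizer for the template itself. The obstacle is the
    net behind the lower bound. The error at a net point is multiplied by the upper bound [b], while
    the target is only [b / kappa], so the mesh has to be of order [1 / kappa] and the net has about
    [kappa ^ d] points up to a factor exponential in [d]. Since [d <= x ^ 2 * k], this comes back as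
    a factor [kappa ^ (x ^ 2)] per index, to be beaten by a tail bound that gains one power of
    [kappa] per index. What remains is [kappa ^ (1 - x ^ 2)], which must exceed the base of the
    bound with a margin. This feedback is why the result is a power with exponent slightly above 1,
    and why [lambda] must stay away from 1. *)

Section gaussian_integral.
Context {R : realType}.
Local Notation mu := (@lebesgue_measure R).
Local Open Scope ereal_scope.

(** The Radon-Nikodym density is determined only almost everywhere; it is identified with
    [normal_pdf] by comparing integrals over measurable sets. *)
Lemma ge0_integral_normal_prob (m s : R) (f : R -> \bar R) :
  (forall x, 0 <= f x) -> measurable_fun setT f ->
  \int[normal_prob m s]_x f x = \int[mu]_x (f x * (normal_pdf m s x)%:E).
Proof.
move=> f0 mf.
have dom := normal_prob_dominates m s.
rewrite -(Radon_Nikodym_SigmaFinite.change_of_variables dom)//.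
have mpdf : measurable_fun setT (fun x => (normal_pdf m s x)%:E).
  by apply/measurable_EFinP; exact: measurable_normal_pdf.
have irn := Radon_Nikodym_SigmaFinite.f_integrable dom.
apply: ae_eq_integral => //.
- by apply: emeasurable_funM => //; exact: measurable_int irn.
- exact: emeasurable_funM.
- apply: ae_eqe_mul2l; apply: integral_ae_eq => // E _ mE.
  by rewrite -Radon_Nikodym_SigmaFinite.f_integral.
Qed.

(* Completing the square turns the integrand into a multiple of another normal density. *)
Lemma integral_normal_expR_sqr (th v r : R) : (0 < 1 + 2 * th * v ^+ 2)%R ->
  \int[normal_prob 0 1]_x (expR (- th * (v * x + r) ^+ 2))%:E =
  ((Num.sqrt (1 + 2 * th * v ^+ 2))^-1
    * expR (- (th / (1 + 2 * th * v ^+ 2)) * r ^+ 2))%:E.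
Proof.
set D := (1 + _)%R => D0.
have sD0 : (0 < Num.sqrt D)%R by rewrite sqrtr_gt0.
have D2 : (Num.sqrt D ^+ 2 = D)%R by rewrite sqr_sqrtr// ltW.
have mexp : measurable_fun setT (fun x => expR (- th * (v * x + r) ^+ 2)%R).
  apply: measurableT_comp => //=; apply: measurable_funM => //=.
  apply: measurable_funX => //=; apply: measurable_funD => //=.
rewrite ge0_integral_normal_prob//; last exact/measurable_EFinP.
(* Mean and deviation come from [2 th (v x + r)^2 + x^2 = D (x - m')^2 + (2 th / D) r^2]. *)
pose m' := (- (2 * th * v * r) / D)%R.
pose s' := ((Num.sqrt D)^-1)%R.
have s'0 : (s' != 0)%R by rewrite invr_eq0 gt_eqF.
transitivity (\int[mu]_x (((Num.sqrt D)^-1 * expR (- (th / D) * r ^+ 2))%:E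
   * (normal_pdf m' s' x)%:E)).
  apply: eq_integral => x _; rewrite -!EFinM; congr EFin.
  rewrite !normal_pdfE// ?oner_neq0//.
  rewrite /normal_fun /normal_peak.
  have -> : (s' ^+ 2 * pi *+ 2 = D^-1 * (1 ^+ 2 * pi *+ 2))%R.
    by rewrite /s' exprVn D2 expr1n mul1r -mulrnAr.
  rewrite sqrtrM ?invr_ge0 ?ltW// sqrtrV ?ltW// invfM invrK.
  set pk := (Num.sqrt (1 ^+ 2 * pi *+ 2))^-1%R.
  rewrite [LHS](_ : _ = pk * (expR (- th * (v * x + r) ^+ 2) *
    expR (- (x - 0) ^+ 2 / (1 ^+ 2 *+ 2))))%R; last by ring.
  rewrite [RHS](_ : _ = pk * (expR (- (th / D) * r ^+ 2) *
    expR (- (x - m') ^+ 2 / (s' ^+ 2 *+ 2))))%R; last first.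
    by move: sD0 => /gt_eqF/negbT sDn0; field.
  rewrite -!expRD; congr (_ * expR _)%R.
  rewrite /s' /m' exprVn D2 /D; move: D0 => /gt_eqF/negbT; rewrite /D => Dn0.
  by field.
have c0 : (0 <= (Num.sqrt D)^-1 * expR (- (th / D) * r ^+ 2))%R.
  by rewrite mulr_ge0// ?expR_ge0// invr_ge0 ltW.
rewrite ge0_integralZl ?lee_fin//.
- by rewrite integral_normal_pdf mule1.
- by apply/measurable_EFinP; exact: measurable_normal_pdf.
- by move=> x _; rewrite lee_fin normal_pdf_ge0.
Qed.

End gaussian_integral.

Section independence.
Context {R : realType} {dT : measure_display} {T : measurableType dT}.
Variable P : probability T R.
Local Open Scope ereal_scope.

Definition independent_family (N : nat) (X : 'I_N -> T -> R) :=
  forall B : 'I_N -> set R, (forall i, measurable (B i)) ->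
    P [set w | forall i, B i (X i w)] = \prod_(i < N) P (X i @^-1` B i).

Definition box (N : nat) (B : 'I_N -> set R) : set (N.-tuple R) :=
  [set t | forall i, B i (tnth t i)].

Lemma measurable_box N (B : 'I_N -> set R) :
  (forall i, measurable (B i)) -> measurable (box B).
Proof.
move=> mB.
have -> : box B = \bigcap_(i in [set: 'I_N]) ((fun t => tnth t i) @^-1` B i).
  by apply/seteqP; split => [t h i _|t h i]; exact: h.
apply: fin_bigcap_measurable => // i _.
by rewrite -[X in measurable X]setTI; exact: measurable_tnth.
Qed.

(** Boxes are stable under intersection and generate the sigma-algebra of tuples, so the uniqueness
    theorem for measures applies. *)
Lemma tuple_measure_unique N (m1 m2 : {measure set (N.-tuple R) -> \bar R}) :
  m1 setT < +oo ->
  (forall B, (forall i, measurable (B i)) -> m1 (box B) = m2 (box B)) ->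
  forall A, measurable A -> m1 A = m2 A.
Proof.
move=> m1oo m12 A mA.
pose C := [set A | exists2 B : 'I_N -> set R,
  (forall i, measurable (B i)) & A = box B].
apply: (measure_unique C (fun=> setT)) => //.
- rewrite eqEsubset; split; last first.
    apply: smallest_sub; first exact: sigma_algebra_measurable.
    by move=> _ [B mB ->]; exact: measurable_box.
  apply: smallest_sub; first exact: smallest_sigma_algebra.
  move=> E; rewrite -bigcup_seq => -[i _ [B mB <-]].
  apply: sub_sigma_algebra; exists (fun j => if j == i then B else setT).
    by move=> j; case: ifP.
  apply/seteqP; split => t /=.
    by move=> [_ Bt] j; case: eqP => // ->.
  by move=> /(_ i); rewrite eqxx.
- move=> _ _ [B1 m1' ->] [B2 m2' ->]; exists (fun i => B1 i `&` B2 i).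
    by move=> i; exact: measurableI.
  apply/seteqP; split => t /=; first by move=> [h1 h2] i; split; [exact: h1|exact: h2].
  by move=> h; split => i; have [] := h i.
- move=> _; exists (fun=> setT) => //.
  by apply/seteqP; split.
- by rewrite bigcup_const.
- by move=> _ [B mB ->]; exact: m12.
Qed.

Lemma measurable_mktuple N (X : 'I_N -> T -> R) :
  (forall i, measurable_fun setT (X i)) ->
  measurable_fun setT (fun w => [tuple X i w | i < N]).
Proof.
move=> mX; apply/measurable_fun_tnthP => i.
rewrite (_ : _ \o _ = X i)//.
by apply/funext => w /=; rewrite tnth_mktuple.
Qed.

(** For fixed [D] both sides are finite measures in [E]: the law of the tuple under [P] restricted
    to [D], and [P D] times its law under [P]. *)
Lemma independent_event_tuple N (X : 'I_N -> T -> R) (D : set T) :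
  (forall i, measurable_fun setT (X i)) -> measurable D ->
  (forall B : 'I_N -> set R, (forall i, measurable (B i)) ->
    P ([set w | forall i, B i (X i w)] `&` D) =
    P [set w | forall i, B i (X i w)] * P D) ->
  forall E : set (N.-tuple R), measurable E ->
    P ([set w | E [tuple X i w | i < N]] `&` D) =
    P [set w | E [tuple X i w | i < N]] * P D.
Proof.
move=> mX mD XD E mE.
have mt := measurable_mktuple mX.
pose t : {mfun T >-> N.-tuple R} := mfun_Sub (mem_set mt).
have cD : (0 <= fine (P D))%R by apply: fine_ge0.
have boxE B : t @^-1` box B = [set w | forall i, B i (X i w)].
  by apply/seteqP; split => w /= h i; have := h i; rewrite /= tnth_mktuple.
have := @tuple_measure_unique N (pushforward (mrestr P mD) t)
  (mscale (NngNum cD) (pushforward P t)) _ _ E mE.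
rewrite /= /mscale /= /pushforward /mrestr /=.
rewrite fineK ?fin_num_measure// muleC; apply.
- by [].
- by [].
- by rewrite preimage_setT setTI; exact: (le_lt_trans (probability_le1 P mD) (ltry _)).
- by move=> B mB; have := XD B mB; rewrite -boxE => ->; rewrite muleC.
Qed.

(* Rows pass one at a time from boxes to arbitrary measurable sets, since finite
   measures agreeing on boxes are equal. *)
Lemma independent_rows (n d : nat) (Z : 'I_n -> 'I_d -> {RV P >-> R}) :
  mutually_independent Z ->
  forall E : 'I_n -> set (d.-tuple R), (forall i, measurable (E i)) ->
  P [set w | forall i, E i [tuple Z i j w | j < d]] =
  \prod_(i < n) P [set w | E i [tuple Z i j w | j < d]].
Proof.
move=> indZ.
(* The first [k] rows carry arbitrary events and the others still carry boxes; [k = 0] is the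
   independence hypothesis. *)
suff H (k : nat) (E : 'I_n -> set (d.-tuple R)) : (forall i, measurable (E i)) ->
    (forall i : 'I_n, (k <= i)%N -> exists2 B : 'I_d -> set R,
       (forall j, measurable (B j)) & E i = box B) ->
    P [set w | forall i, E i [tuple Z i j w | j < d]] =
    \prod_(i < n) P [set w | E i [tuple Z i j w | j < d]].
  move=> E mE; apply: (H n) => // i; by rewrite leqNgt ltn_ord.
have mrow i : measurable_fun setT (fun w => [tuple Z i j w | j < d]).
  exact: measurable_mktuple.
have mrowE i (A : set (d.-tuple R)) :
    measurable A -> measurable [set w | A [tuple Z i j w | j < d]].
  by move=> mA; rewrite -[X in measurable X]setTI; exact: mrow.
elim: k E => [|k IH] E mE hE.
  have /choice[B hB] : forall i : 'I_n, exists B : 'I_d -> set R,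
      (forall j, measurable (B j)) /\ E i = box B.
    by move=> i; have [B] := hE i (leq0n _); exists B.
  have Erow i w : E i [tuple Z i j w | j < d] = (forall j, B i j (Z i j w)).
    rewrite (hB i).2; apply/propext; split => h j.
      by have := h j; rewrite tnth_mktuple.
    by rewrite tnth_mktuple.
  rewrite (_ : [set w | _] = [set w | forall i j, B i j (Z i j w)]); last first.
    by apply/seteqP; split => w /= h i; have := h i; rewrite Erow.
  rewrite indZ; last by move=> i j; exact: (hB i).1.
  apply: eq_bigr => i _.
  under [in RHS]eq_set do rewrite Erow.
  pose B' i' j' := if i' == i then B i j' else setT.
  have := indZ B' _; rewrite (bigD1 i)//= [X in _ * X]big1 ?mule1; last first.
    move=> i' /negbTE i'i; apply: big1 => j _.
    by rewrite /B' i'i preimage_setT probability_setT.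
  rewrite /B' eqxx => <-; last by move=> i' j; case: ifP => // _; exact: (hB i).1.
  congr (P _); apply/seteqP; split => w /=.
    by move=> h j; have := h i j; rewrite eqxx.
  by move=> h i' j; case: eqP => // ->.
have [kn|nk] := ltnP k n; last first.
  apply: IH => // i ki; have := leq_ltn_trans (leq_trans nk ki) (ltn_ord i).
  by rewrite ltnn.
pose i0 := Ordinal kn.
(* When [A] is a box, the induction hypothesis covers [rep A]. Comparing a general box with
   [A = setT] shows that row [i0] is independent of the event [D] on the other rows, at first for
   boxes only. *)
pose rep A i := if i == i0 then A else E i.
have repE A : measurable A -> (exists2 B : 'I_d -> set R,
       (forall j, measurable (B j)) & A = box B) ->
    P [set w | forall i, rep A i [tuple Z i j w | j < d]] =
    P [set w | A [tuple Z i0 j w | j < d]] *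
    \prod_(i < n | i != i0) P [set w | E i [tuple Z i j w | j < d]].
  move=> mA bA; rewrite IH.
  - rewrite (bigD1 i0)//= /rep eqxx; congr (_ * _).
    by apply: eq_bigr => i /negbTE ->.
  - by move=> i; rewrite /rep; case: ifP.
  - move=> i ki; rewrite /rep; case: ifPn => // ii0; apply: hE.
    by rewrite ltn_neqAle ki andbT eq_sym; apply: contra_neqN ii0 => /eqP e; exact: val_inj.
pose D := [set w | forall i, i != i0 -> E i [tuple Z i j w | j < d]].
have mD : measurable D.
  have -> : D = \bigcap_(i in [set i | i != i0]) [set w | E i [tuple Z i j w | j < d]].
    by apply/seteqP; split => w h i; exact: h.
  by apply: fin_bigcap_measurable => [|i _]; [exact: finite_finset|exact: mrowE].
have splitE A : [set w | forall i, rep A i [tuple Z i j w | j < d]] =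
    [set w | A [tuple Z i0 j w | j < d]] `&` D.
  apply/seteqP; split => w /=.
    move=> h; split; first by have := h i0; rewrite /rep eqxx.
    by move=> i ii0; have := h i; rewrite /rep (negbTE ii0).
  by move=> [hA hD] i; rewrite /rep; case: eqVneq => [->//|]; exact: hD.
have boxT : setT = box (fun=> setT) :> set (d.-tuple R) by apply/seteqP; split.
have PD : P D = \prod_(i < n | i != i0) P [set w | E i [tuple Z i j w | j < d]].
  have := repE setT measurableT; rewrite splitE.
  rewrite (_ : [set _ | _] = setT); last by apply/seteqP; split.
  by rewrite setTI probability_setT mul1e; apply; exists (fun=> setT).
have -> : [set w | forall i, E i [tuple Z i j w | j < d]] =
    [set w | E i0 [tuple Z i0 j w | j < d]] `&` D.
  rewrite -splitE; apply/seteqP; split => w /= h i; have := h i; rewrite /rep;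
    by case: eqP => // ->.
rewrite (bigD1 i0)//= -PD.
apply: (independent_event_tuple (X := fun j => Z i0 j)) => // B mB.
have BE : [set w | forall j, B j (Z i0 j w)] = [set w | box B [tuple Z i0 j w | j < d]].
  by apply/seteqP; split => w /= h i; have := h i; rewrite /= tnth_mktuple.
rewrite BE -splitE repE ?PD//; first exact: measurable_box.
by exists B.
Qed.

End independence.

Lemma widen_ord_lift_max N (j : 'I_N) : widen_ord (leqnSn N) j = lift ord_max j.
Proof. by apply: val_inj; rewrite /= /bump leqNgt ltn_ord. Qed.

(** * Integrals of functions of independent variables *)

Section independent_integrals.
Context {R : realType} {dT : measure_display} {T : measurableType dT}.
Variable P : probability T R.
Local Open Scope ereal_scope.

(** The joint law is the product of the two laws; Tonelli then integrates [X] out with [Y]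
    frozen. *)
Lemma integral_independent_pair (X Y : T -> R) (f : R * R -> \bar R) :
  measurable_fun setT X -> measurable_fun setT Y ->
  (forall A B, measurable A -> measurable B ->
     P (X @^-1` A `&` Y @^-1` B) = P (X @^-1` A) * P (Y @^-1` B)) ->
  (forall p, 0 <= f p) -> measurable_fun setT f ->
  \int[P]_w f (X w, Y w) = \int[P]_w \int[P]_w' f (X w', Y w).
Proof.
move=> mX mY ind f0 mf.
have mXY : measurable_fun setT (fun w => (X w, Y w)).
  exact/measurable_fun_pairP.
pose X' : {mfun T >-> R} := mfun_Sub (mem_set mX).
pose Y' : {mfun T >-> R} := mfun_Sub (mem_set mY).
pose XY : {mfun T >-> (R * R)%type} := mfun_Sub (mem_set mXY).
have -> : \int[P]_w f (X w, Y w) = \int[pushforward P XY]_p f p.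
  by rewrite ge0_integral_pushforward.
rewrite (eq_measure_integral (distribution P X' \x distribution P Y')); last first.
  by move=> A mA _; apply/esym; apply: product_measure_unique => //.
rewrite fubini_tonelli2// ge0_integral_pushforward//.
- apply: eq_integral => w _ /=.
  rewrite /fubini_G /= ge0_integral_pushforward//.
  exact: measurableT_comp.
- exact: measurable_fun_fubini_tonelli_G.
- by move=> y _; apply: integral_ge0.
Qed.

Lemma independent_family_last N (X : 'I_N.+1 -> T -> R) :
  (forall i, measurable_fun setT (X i)) -> independent_family P X ->
  forall (A : set R) (E : set (N.-tuple R)), measurable A -> measurable E ->
  P (X ord_max @^-1` A `&`
     [set w | E [tuple X (widen_ord (leqnSn N) i) w | i < N]]) =
  P (X ord_max @^-1` A) *
  P [set w | E [tuple X (widen_ord (leqnSn N) i) w | i < N]].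
Proof.
move=> mX indX A E mA mE.
rewrite setIC muleC; apply: independent_event_tuple => //.
  by rewrite -[X in measurable X]setTI; exact: mX.
move=> B mB.
pose B' (C : set R) i := if unlift ord_max i is Some j then B j else C.
have mB' C : measurable C -> forall i, measurable (B' C i).
  by move=> mC i; rewrite /B'; case: unliftP.
have unw j : unlift ord_max (widen_ord (leqnSn N) j) = Some j.
  by rewrite widen_ord_lift_max liftK.
have PB' C : measurable C ->
  P [set w | forall i, B' C i (X i w)] =
  \prod_(i < N) P (X (widen_ord (leqnSn N) i) @^-1` B i) * P (X ord_max @^-1` C).
  move=> mC; rewrite indX; last exact: mB'.
  rewrite big_ord_recr /= /B' unlift_none; congr (_ * _).
  by apply: eq_bigr => i _; rewrite unw.
have B'E C : [set w | forall i, B' C i (X i w)] =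
  [set w | forall i, B i (X (widen_ord (leqnSn N) i) w)] `&` (X ord_max @^-1` C).
  apply/seteqP; split => w /=.
    move=> h; split.
      by move=> i; have := h (widen_ord (leqnSn N) i); rewrite /B' unw.
    by have := h ord_max; rewrite /B' unlift_none.
  move=> [h hC] i; rewrite /B'; case: unliftP => [j|] ->//.
  by have := h j; rewrite widen_ord_lift_max.
rewrite -B'E PB'//; congr (_ * _).
have := PB' setT measurableT.
by rewrite B'E preimage_setT setIT probability_setT mule1 => ->.
Qed.

Lemma independent_family_widen N (X : 'I_N.+1 -> T -> R) :
  independent_family P X ->
  independent_family P (fun i => X (widen_ord (leqnSn N) i)).
Proof.
move=> indX B mB.
pose B' i := if unlift ord_max i is Some j then B j else setT.
have unw j : unlift ord_max (widen_ord (leqnSn N) j) = Some j.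
  by rewrite widen_ord_lift_max liftK.
have := indX B' _; rewrite big_ord_recr /= /B' unlift_none preimage_setT.
rewrite probability_setT mule1.
under [in X in _ = X]eq_bigr do rewrite unw.
move=> <-; last by move=> i; case: unliftP.
congr (P _); apply/seteqP; split => w /=.
  move=> h i; case: unliftP => [j|] ->//.
  by have := h j; rewrite widen_ord_lift_max.
by move=> h i; have := h (widen_ord (leqnSn N) i); rewrite unw.
Qed.

Lemma integral_independent_last N (X : 'I_N.+1 -> T -> R) (S : N.-tuple R -> R)
    (f : R * R -> \bar R) :
  (forall i, measurable_fun setT (X i)) -> independent_family P X ->
  measurable_fun setT S ->
  (forall p, 0 <= f p) -> measurable_fun setT f ->
  let Y w := S [tuple X (widen_ord (leqnSn N) i) w | i < N] in
  \int[P]_w f (X ord_max w, Y w) = \int[P]_w \int[P]_w' f (X ord_max w', Y w).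
Proof.
move=> mX indX mS f0 mf Y.
apply: integral_independent_pair => //.
  by apply: measurableT_comp => //; exact: measurable_mktuple.
move=> A B mA mB; apply: (independent_family_last mX indX mA (E := S @^-1` B)).
by rewrite -[X in measurable X]setTI; exact: mS.
Qed.

Lemma measurable_sum_tnth N (v : 'I_N -> R) :
  measurable_fun setT (fun t : N.-tuple R => \sum_(i < N) v i * tnth t i)%R.
Proof.
apply: measurable_sum => i; apply: measurable_funM => //.
exact: measurable_tnth.
Qed.

Lemma integral_comp_std_gaussian (X : T -> R) (g : R -> \bar R) :
  measurable_fun setT X ->
  (forall A, measurable A -> P (X @^-1` A) = normal_prob 0 1 A) ->
  (forall x, 0 <= g x) -> measurable_fun setT g ->
  \int[P]_w g (X w) = \int[normal_prob 0 1]_x g x.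
Proof.
move=> mX gX g0 mg.
have mX0 : @measurable_fun _ _ T (measurableTypeR R) setT X by exact: mX.
pose X' : {mfun T >-> measurableTypeR R} :=
  @mfun_Sub _ _ T (measurableTypeR R) X (mem_set mX0).
have -> : \int[P]_w g (X w) = \int[pushforward P X']_x g x.
  by rewrite ge0_integral_pushforward.
by apply: eq_measure_integral => A mA _; exact: gX.
Qed.

(** Integrating out the last variable with coefficient [u] keeps the shape of the integrand: [th]
    becomes [th / D] with [D = 1 + 2 th u^2], and the normalizing factors multiply to the stated
    one. The stability of Gaussian laws under sums is thereby avoided. *)
Lemma integral_expR_gaussian_sum N (X : 'I_N -> T -> R) (v : 'I_N -> R) (th : R) :
  (forall i, measurable_fun setT (X i)) -> independent_family P X ->
  (forall i A, measurable A -> P (X i @^-1` A) = normal_prob 0 1 A) ->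
  (0 < 1 + 2 * th * \sum_(i < N) v i ^+ 2)%R ->
  \int[P]_w (expR (- th * (\sum_(i < N) v i * X i w) ^+ 2))%:E =
  ((Num.sqrt (1 + 2 * th * \sum_(i < N) v i ^+ 2))^-1)%:E.
Proof.
elim: N X v th => [|N IH] X v th mX indX gX.
  rewrite big_ord0 mulr0 addr0 sqrtr1 invr1 => _.
  under eq_integral do rewrite big_ord0 expr0n mulr0 expR0.
  by rewrite integral_cst// mul1e; exact: probability_setT.
rewrite big_ord_recr /=; set V := (\sum_(i < N) _)%R; set u := v ord_max => DV.
have V0 : (0 <= V)%R by apply: sumr_ge0 => i _; exact: sqr_ge0.
have u0 : (0 <= u ^+ 2)%R by exact: sqr_ge0.
(* [th] is negative in the upper tail; this quantity is then at least the full one, which is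
   positive by assumption. *)
have Du : (0 < 1 + 2 * th * u ^+ 2)%R.
  have [th0|th0] := leP 0%R th; last by nra.
  by have := mulr_ge0 th0 u0; lra.
pose S (t : N.-tuple R) := (\sum_(i < N) v (widen_ord (leqnSn N) i) * tnth t i)%R.
have mS : measurable_fun setT S by exact: measurable_sum_tnth.
pose f (p : R * R) := (expR (- th * (u * p.1 + p.2) ^+ 2))%:E.
have mf : measurable_fun setT f.
  apply/measurable_EFinP; apply: measurableT_comp => //=.
  apply: measurable_funM => //=; apply: measurable_funX => //=.
  by apply: measurable_funD => //=; exact: measurable_funM.
transitivity (\int[P]_w f (X ord_max w, S [tuple X (widen_ord (leqnSn N) i) w | i < N])).
  apply: eq_integral => w _; rewrite /f /S /= big_ord_recr /= addrC.
  congr (expR (_ * (_ + _) ^+ 2))%:E.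
  by apply: eq_bigr => i _; rewrite tnth_mktuple.
rewrite (integral_independent_last mX indX mS)//; last by move=> p; rewrite lee_fin expR_ge0.
set D := (1 + 2 * th * u ^+ 2)%R in Du.
transitivity (\int[P]_w (((Num.sqrt D)^-1)%:E * (expR (- (th / D) *
   (\sum_(i < N) v (widen_ord (leqnSn N) i) * X (widen_ord (leqnSn N) i) w) ^+ 2))%:E)).
  apply: eq_integral => w _.
  rewrite (integral_comp_std_gaussian
    (g := fun x => f (x, S [tuple X (widen_ord (leqnSn N) i) w | i < N]))
    (mX ord_max))//; first last.
  - exact: measurableT_comp.
  - by move=> y; rewrite lee_fin expR_ge0.
  - exact: gX.
  rewrite /f /= integral_normal_expR_sqr// -EFinM; congr (_ * expR (_ * _ ^+ 2))%:E.
  by apply: eq_bigr => i _; rewrite tnth_mktuple.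
have sD : (0 < Num.sqrt D)%R by rewrite sqrtr_gt0.
rewrite ge0_integralZl ?lee_fin ?invr_ge0 ?(ltW sD)//; last first.
- apply/measurable_EFinP; apply: measurableT_comp => //=.
  apply: measurable_funM => //=; apply: measurable_funX => //=.
  by apply: measurable_sum => i; exact: measurable_funM.
have e : (1 + 2 * (th / D) * V = (1 + 2 * th * (V + u ^+ 2)) / D)%R.
  by rewrite /D; field; exact: lt0r_neq0.
rewrite IH//; first last.
- by rewrite -/V e divr_gt0.
- by move=> i A; exact: gX.
- exact: independent_family_widen.
rewrite -/V e -EFinM; congr EFin.
rewrite sqrtrM ?(ltW DV)// sqrtrV ?ltW// invfM invrK mulrCA mulVf ?mulr1//.
exact: lt0r_neq0.
Qed.

Lemma integral_prod_independent N (X : 'I_N -> T -> R) (f : 'I_N -> R -> R) :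
  (forall i, measurable_fun setT (X i)) -> independent_family P X ->
  (forall i x, 0 <= f i x)%R -> (forall i, measurable_fun setT (f i)) ->
  \int[P]_w (\prod_(i < N) f i (X i w))%:E =
  \prod_(i < N) \int[P]_w (f i (X i w))%:E.
Proof.
elim: N X f => [|N IH] X f mX indX f0 mf.
  rewrite big_ord0; under eq_integral do rewrite big_ord0.
  by rewrite integral_cst// mul1e; exact: probability_setT.
rewrite big_ord_recr /=.
rewrite -(IH (fun i => X (widen_ord (leqnSn N) i))
  (fun i => f (widen_ord (leqnSn N) i)))//; last exact: independent_family_widen.
pose S (t : N.-tuple R) := (\prod_(i < N) f (widen_ord (leqnSn N) i) (tnth t i))%R.
have mS : measurable_fun setT S.
  apply: measurable_prod => i _.
  exact: (measurableT_comp (mf _) (measurable_tnth _)).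
(* The absolute value makes [g] nonnegative on the whole plane, as Tonelli demands; it changes
   nothing on the values of [S] that occur. *)
pose g (p : R * R) := (f ord_max p.1 * `|p.2|)%:E.
have mg : measurable_fun setT g.
  apply/measurable_EFinP; apply: measurable_funM => //=.
    exact: measurableT_comp.
  exact: measurableT_comp.
have SE w : S [tuple X (widen_ord (leqnSn N) i) w | i < N] =
    (\prod_(i < N) f (widen_ord (leqnSn N) i) (X (widen_ord (leqnSn N) i) w))%R.
  by apply: eq_bigr => i _; rewrite tnth_mktuple.
have S0 w : (0 <= \prod_(i < N) f (widen_ord (leqnSn N) i) (X (widen_ord (leqnSn N) i) w))%R.
  by apply: prodr_ge0.
transitivity (\int[P]_w g (X ord_max w, S [tuple X (widen_ord (leqnSn N) i) w | i < N])).
  by apply: eq_integral => w _; rewrite /g big_ord_recr /= SE ger0_norm// mulrC.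
rewrite (integral_independent_last mX indX mS)//; last first.
  by move=> p; rewrite lee_fin mulr_ge0.
have mfX : measurable_fun setT (fun w => (f ord_max (X ord_max w))%:E).
  by apply/measurable_EFinP; exact: measurableT_comp.
rewrite muleC -ge0_integralZl//; first last.
- by apply: integral_ge0 => w _; rewrite lee_fin.
- by move=> w _; rewrite lee_fin.
- apply/measurable_EFinP; apply: measurable_prod => i _; exact: measurableT_comp.
apply: eq_integral => w _.
rewrite /g /= SE ger0_norm//.
under eq_integral do rewrite EFinM.
rewrite ge0_integralZr ?lee_fin// => w' _.
by rewrite lee_fin.
Qed.

End independent_integrals.

(** * Chernoff bounds for chi-square variables *)

Section chi_square_tails.
Context {R : realType} {dT : measure_display} {T : measurableType dT}.
Variable P : probability T R.
Variables (n d : nat) (Z : 'I_n -> 'I_d -> {RV P >-> R}).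
Hypothesis gZ : forall i j, std_gaussian (Z i j).
Hypothesis indZ : mutually_independent Z.
Local Open Scope ereal_scope.

Lemma independent_family_row i : independent_family P (fun j => Z i j).
Proof.
move=> B mB; pose B' i' j := if i' == i then B j else setT.
have := indZ (B := B') _; rewrite (bigD1 i)//= [X in _ * X]big1 ?mule1; last first.
  move=> i' /negbTE i'i; apply: big1 => j _.
  by rewrite /B' i'i preimage_setT probability_setT.
rewrite /B' eqxx => <-; last by move=> i' j; case: ifP.
congr (P _); apply/seteqP; split => w /=.
  by move=> h i' j; case: eqP => // ->.
by move=> h j; have := h i j; rewrite eqxx.
Qed.

(** The preimage of a set under a linear form of a row is not a box, which is why independence of
    rows was extended to arbitrary measurable events. *)
Lemma independent_family_row_comb (v : 'I_n -> 'I_d -> R) :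
  independent_family P (fun i w => \sum_(j < d) v i j * Z i j w)%R.
Proof.
move=> B mB.
pose E i := (fun t : d.-tuple R => \sum_(j < d) v i j * tnth t j)%R @^-1` B i.
have mE i : measurable (E i).
  by rewrite -[X in measurable X]setTI; exact: measurable_sum_tnth.
have EB i w : E i [tuple Z i j w | j < d] = B i (\sum_(j < d) v i j * Z i j w)%R.
  by rewrite /E /=; congr (B i _); apply: eq_bigr => j _; rewrite tnth_mktuple.
have := independent_rows indZ mE.
under eq_set do under eq_forall do rewrite EB.
move=> ->; apply: eq_bigr => i _; congr (P _).
by apply/seteqP; split => w; rewrite /= EB.
Qed.

Lemma integral_expR_sum_sqr (v : 'I_n -> 'I_d -> R) (I : {set 'I_n}) (a : R) :
  (forall i, \sum_(j < d) v i j ^+ 2 = 1)%R -> (0 < 1 + 2 * a)%R ->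
  \int[P]_w (expR (- a * \sum_(i in I) (\sum_(j < d) v i j * Z i j w) ^+ 2))%:E =
  ((Num.sqrt (1 + 2 * a))^-1 ^+ #|I|)%:E.
Proof.
move=> v1 a0.
pose Y i w := (\sum_(j < d) v i j * Z i j w)%R.
pose f i y := if i \in I then expR (- a * y ^+ 2) else 1%R.
have mY i : measurable_fun setT (Y i).
  by apply: measurable_sum => j; exact: measurable_funM.
transitivity (\int[P]_w (\prod_(i < n) f i (Y i w))%:E).
  apply: eq_integral => w _; congr EFin; rewrite mulr_sumr expR_sum.
  by rewrite big_mkcond /=; apply: eq_bigr => i _; rewrite /f; case: ifP.
have f0 i x : (0 <= f i x)%R.
  by rewrite /f; case: ifP => // _; exact: expR_ge0.
have mf i : measurable_fun setT (f i).
  rewrite /f; case: (i \in I) => //.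
  apply: measurableT_comp => //=; apply: measurable_funM => //=.
rewrite (integral_prod_independent mY (independent_family_row_comb v) f0 mf).
have fE i : \int[P]_w (f i (Y i w))%:E =
    (if i \in I then (Num.sqrt (1 + 2 * a))^-1 else 1%R)%:E.
  rewrite /f; case: (i \in I); last first.
    by rewrite integral_cst// mul1e; exact: probability_setT.
  have /= := @integral_expR_gaussian_sum _ _ _ P _ (fun j => Z i j) (v i) a.
  rewrite v1 mulr1; apply => //; first exact: independent_family_row.
  by move=> j A mA; exact: gZ.
under eq_bigr do rewrite fE.
by rewrite prodEFin; congr EFin; rewrite -prodr_const [RHS]big_mkcond.
Qed.

Lemma probability_le_integral (A : set T) (g : T -> R) :
  measurable A -> measurable_fun setT g -> (forall w, 0 <= g w)%R ->
  (forall w, A w -> 1 <= g w)%R -> P A <= \int[P]_w (g w)%:E.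
Proof.
move=> mA mg g0 gA.
have <- : \int[P]_w (\1_A w)%:E = P A by rewrite integral_indic// setIT.
apply: ge0_le_integral => //.
- by apply/measurable_EFinP; exact: measurable_indic.
- exact/measurable_EFinP.
- move=> w _; rewrite lee_fin indicE; case: (boolP (w \in A)) => //= /set_mem.
  exact: gA.
Qed.

Lemma measurable_sum_sqr (v : 'I_n -> 'I_d -> R) (I : {set 'I_n}) :
  measurable_fun setT (fun w => \sum_(i in I) (\sum_(j < d) v i j * Z i j w) ^+ 2)%R.
Proof.
under eq_fun do rewrite big_mkcond /=.
apply: measurable_sum => i; case: (i \in I) => //.
by apply: measurable_funX; apply: measurable_sum => j; exact: measurable_funM.
Qed.

(** The sign of [a] is left open: positive [a] serves the lower tail, and [a] between [-1/2] and [0]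
    the upper tail. *)
Lemma chernoff_sum_sqr (v : 'I_n -> 'I_d -> R) (I : {set 'I_n}) (a b : R) (A : set T) :
  (forall i, \sum_(j < d) v i j ^+ 2 = 1)%R -> (0 < 1 + 2 * a)%R ->
  measurable A ->
  (forall w, A w -> a * \sum_(i in I) (\sum_(j < d) v i j * Z i j w) ^+ 2 <= b)%R ->
  P A <= (expR b * (Num.sqrt (1 + 2 * a))^-1 ^+ #|I|)%:E.
Proof.
move=> v1 a0 mA Ab.
pose g w := expR (- a * \sum_(i in I) (\sum_(j < d) v i j * Z i j w) ^+ 2).
have mg : measurable_fun setT g.
  apply: measurableT_comp => //=; apply: measurable_funM => //=.
  exact: measurable_sum_sqr.
apply: (le_trans (probability_le_integral (g := fun w => (expR b * g w)%R) mA _ _ _)).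
- exact: measurable_funM.
- by move=> w; rewrite mulr_ge0 ?expR_ge0.
- move=> w /Ab; rewrite /g -expRD => h; rewrite -[leLHS]expR0 ler_expR.
  by rewrite mulNr subr_ge0.
- under eq_integral do rewrite EFinM.
  rewrite ge0_integralZl ?lee_fin ?expR_ge0//.
  + by rewrite integral_expR_sum_sqr.
  + exact/measurable_EFinP.
  + by move=> w _; rewrite lee_fin expR_ge0.
Qed.

(** The choice [a = (s^(-2) - 1) / 2] makes [1 + 2 a = s^(-2)], so each index contributes a factor
    [s]; the exponent [a s^2 = (1 - s^2) / 2] is bounded by [1/2]. *)
Lemma sum_sqr_lower_tail (v : 'I_n -> 'I_d -> R) (I : {set 'I_n}) (s : R) :
  (forall i, \sum_(j < d) v i j ^+ 2 = 1)%R -> (0 < s <= 1)%R ->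
  P [set w | \sum_(i in I) (\sum_(j < d) v i j * Z i j w) ^+ 2 <= s ^+ 2 * #|I|%:R]%R
  <= ((expR (1 / 2) * s) ^+ #|I|)%:E.
Proof.
move=> v1 /andP[s0 s1].
have sV : (0 < s^-1)%R by rewrite invr_gt0.
have s2 : (1 <= (s ^+ 2)^-1)%R by rewrite invf_ge1 ?exprn_gt0// expr_le1// ltW.
have sn0 : s != 0%R by rewrite gt_eqF.
have e1 : (1 + 2 * (((s ^+ 2)^-1 - 1) / 2) = (s^-1) ^+ 2)%R by field.
apply: (le_trans (chernoff_sum_sqr (a := ((s ^+ 2)^-1 - 1) / 2)
  (b := ((s ^+ 2)^-1 - 1) / 2 * (s ^+ 2 * #|I|%:R)) (I := I) v1 _ _ _)).
- by rewrite e1 exprn_gt0.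
- rewrite -[X in measurable X]setTI.
  by apply: measurable_fun_le => //; exact: measurable_sum_sqr.
- by move=> w /= h; rewrite ler_wpM2l// divr_ge0// subr_ge0.
- rewrite e1 sqrtr_sqr ger0_norm ?(ltW sV)// invrK lee_fin [leRHS]exprMn.
  rewrite ler_wpM2r// ?exprn_ge0 ?(ltW s0)// -expRM_natr ler_expR.
  rewrite mulrA ler_wpM2r//.
  rewrite (_ : _ * _ = (1 - s ^+ 2) / 2)%R; last by field.
  by rewrite ler_wpM2r// gerBl exprn_ge0// ltW.
Qed.

Lemma sum_sqr_upper_tail (v : 'I_n -> 'I_d -> R) (t : R) :
  (forall i, \sum_(j < d) v i j ^+ 2 = 1)%R ->
  P [set w | t * n%:R <= \sum_i (\sum_(j < d) v i j * Z i j w) ^+ 2]%R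
  <= ((2 * expR (- (3 / 8) * t)) ^+ n)%:E.
Proof.
move=> v1.
have sumT w : (\sum_i (\sum_(j < d) v i j * Z i j w) ^+ 2 =
  \sum_(i in [set: 'I_n]%SET) (\sum_(j < d) v i j * Z i j w) ^+ 2)%R.
  by apply: eq_bigl => i; rewrite inE.
under eq_set do rewrite sumT.
(* With [a = -3/8] the square root is exactly [1/2], hence the factor 2 per index. *)
have e1 : (1 + 2 * (- (3 / 8)) = (2^-1 : R) ^+ 2)%R by field.
apply: (le_trans (chernoff_sum_sqr (a := - (3 / 8)) (b := - (3 / 8) * (t * n%:R))
  (I := [set: 'I_n]%SET) v1 _ _ _)).
- by rewrite e1.
- rewrite -[X in measurable X]setTI.
  by apply: measurable_fun_le => //; exact: measurable_sum_sqr.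
- by move=> w /= h; rewrite ler_wnM2l// oppr_le0.
- rewrite e1 sqrtr_sqr ger0_norm// invrK lee_fin cardsT card_ord mulrA expRM_natr.
  by rewrite -exprMn mulrC.
Qed.

End chi_square_tails.

(** * Euclidean geometry and max filters *)

Section euclidean.
Context {R : realType} {d : nat}.
Implicit Types p q u v : 'cV[R]_d.

Lemma innerC p q : inner p q = inner q p.
Proof. by apply: eq_bigr => i _; rewrite mulrC. Qed.

Lemma innerDl p q u : inner (p + q) u = inner p u + inner q u.
Proof. by rewrite -big_split; apply: eq_bigr => i _; rewrite mxE mulrDl. Qed.

Lemma innerZl (a : R) p q : inner (a *: p) q = a * inner p q.
Proof. by rewrite mulr_sumr; apply: eq_bigr => i _; rewrite mxE mulrA. Qed.

Lemma innerNl p q : inner (- p) q = - inner p q.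
Proof. by rewrite -scaleN1r innerZl mulN1r. Qed.

Lemma innerBl p q u : inner (p - q) u = inner p u - inner q u.
Proof. by rewrite innerDl innerNl. Qed.

Lemma innerDr p q u : inner u (p + q) = inner u p + inner u q.
Proof. by rewrite !(innerC u) innerDl. Qed.

Lemma innerBr p q u : inner u (p - q) = inner u p - inner u q.
Proof. by rewrite !(innerC u) innerBl. Qed.

Lemma innerZr (a : R) p q : inner p (a *: q) = a * inner p q.
Proof. by rewrite !(innerC p) innerZl. Qed.

Lemma inner_mxE p q : inner p q = (p^T *m q) 0 0.
Proof. by rewrite mxE; apply: eq_bigr => i _; rewrite mxE. Qed.

Lemma inner_mulmxl (g : 'M[R]_d) p q : inner (g *m p) q = inner p (g^T *m q).
Proof. by rewrite !inner_mxE trmx_mul mulmxA. Qed.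

Lemma inner_ge0 p : 0 <= inner p p.
Proof. by apply: sumr_ge0 => i _; rewrite -expr2 sqr_ge0. Qed.

Lemma inner_eq0 p : (inner p p == 0) = (p == 0).
Proof.
apply/idP/idP => [|/eqP->]; last by rewrite /inner big1// => i _; rewrite mxE mul0r.
rewrite psumr_eq0; last by move=> i _; rewrite -expr2 sqr_ge0.
move=> /allP h; apply/eqP/matrixP => i j; rewrite ord1 mxE.
have := h i (mem_index_enum _); rewrite -expr2 sqrf_eq0 => /eqP ->.
by [].
Qed.

Lemma enormE p : enorm p = Num.sqrt (inner p p).
Proof. by congr Num.sqrt; apply: eq_bigr => i _; rewrite expr2. Qed.

Lemma enorm_sqr p : enorm p ^+ 2 = inner p p.
Proof. by rewrite enormE sqr_sqrtr// inner_ge0. Qed.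

Lemma enorm_ge0 p : 0 <= enorm p.
Proof. exact: sqrtr_ge0. Qed.

Lemma enormN p : enorm (- p) = enorm p.
Proof. by rewrite !enormE innerNl innerC innerNl opprK. Qed.

Lemma enormZ (a : R) p : 0 <= a -> enorm (a *: p) = a * enorm p.
Proof.
move=> a0; rewrite !enormE innerZl innerZr mulrA -expr2 sqrtrM ?sqr_ge0//.
by rewrite sqrtr_sqr ger0_norm.
Qed.

Lemma enorm_eq0 p : (enorm p == 0) = (p == 0).
Proof. by rewrite -sqrf_eq0 enorm_sqr inner_eq0. Qed.

Lemma cauchy_schwarz p q : inner p q ^+ 2 <= inner p p * inner q q.
Proof.
have [/eqP|qn0] := eqVneq (inner q q) 0.
  rewrite inner_eq0 => /eqP ->.
  by rewrite -[0](scale0r (0 : 'cV_d)) innerZr innerZl !mul0r mulr0 expr0n.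
have q0 : 0 < inner q q by rewrite lt_neqAle eq_sym qn0 inner_ge0.
have := inner_ge0 (inner q q *: p - inner p q *: q).
rewrite !(innerBl, innerBr, innerZl, innerZr) (innerC q p) => h.
rewrite -(ler_pM2l q0) -subr_ge0; apply: le_trans h _.
by rewrite le_eqVlt; apply/orP; left; apply/eqP; ring.
Qed.

Lemma inner_le_enorm p q : `|inner p q| <= enorm p * enorm q.
Proof.
rewrite -(@ler_pXn2r _ 2)// ?nnegrE ?mulr_ge0 ?enorm_ge0//.
by rewrite real_normK ?num_real// exprMn !enorm_sqr cauchy_schwarz.
Qed.

Lemma enorm_triangle p q : enorm (p + q) <= enorm p + enorm q.
Proof.
rewrite -(@ler_pXn2r _ 2)// ?nnegrE ?addr_ge0 ?enorm_ge0//.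
rewrite sqrrD !enorm_sqr innerDl !innerDr (innerC q p).
have := le_trans (ler_norm _) (inner_le_enorm p q).
by rewrite mulr2n; lra.
Qed.

Lemma enorm_orth (g : 'M[R]_d) p : g^T *m g = 1%:M -> enorm (g *m p) = enorm p.
Proof. by move=> gg; rewrite !enormE inner_mulmxl mulmxA gg mul1mx. Qed.

End euclidean.

Section seq_extrema.
Context {R : realType} {I : eqType}.
Implicit Types (s : seq I) (F : I -> R).

Lemma bigmaxr_ge s F a i : i \in s -> F i <= \big[Num.max/a]_(j <- s) F j.
Proof.
elim: s => // j s IH; rewrite inE big_cons le_max => /orP[/eqP->|/IH->].
  by rewrite lexx.
by rewrite orbT.
Qed.

Lemma bigmaxr_attained s F a :
  \big[Num.max/a]_(j <- s) F j = a \/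
  exists2 i, i \in s & \big[Num.max/a]_(j <- s) F j = F i.
Proof.
elim: s => [|j s IH]; first by rewrite big_nil; left.
rewrite big_cons; case: leP => _; last by right; exists j => //; rewrite inE eqxx.
by case: IH => [|[i is_ ->]]; [left|right; exists i => //; rewrite inE is_ orbT].
Qed.

Lemma bigminr_le s F a i : i \in s -> \big[Num.min/a]_(j <- s) F j <= F i.
Proof.
elim: s => // j s IH; rewrite inE big_cons ge_min => /orP[/eqP->|/IH->].
  by rewrite lexx.
by rewrite orbT.
Qed.

Lemma bigminr_attained s F a :
  \big[Num.min/a]_(j <- s) F j = a \/
  exists2 i, i \in s & \big[Num.min/a]_(j <- s) F j = F i.
Proof.
elim: s => [|j s IH]; first by rewrite big_nil; left.
rewrite big_cons; case: leP => _; first by right; exists j => //; rewrite inE eqxx.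
by case: IH => [|[i is_ ->]]; [left|right; exists i => //; rewrite inE is_ orbT].
Qed.

Lemma exists_below_positives (s : seq R) (t0 : R) : 0 < t0 ->
  exists2 t, 0 < t < t0 & forall r, r \in s -> 0 < r -> t < r.
Proof.
move=> t00; elim: s => [|r s [t /andP[t1 t2] ht]].
  by exists (t0 / 2) => //; rewrite divr_gt0//= ltr_pdivrMr// mulr_natr mulr2n ltrDl.
have [r0|r0] := ltP 0 r; last first.
  exists t => [|r']; first by rewrite t1.
  by rewrite inE => /orP[/eqP->|/ht//]; rewrite ltNge r0.
exists (Num.min t (r / 2)).
  by rewrite lt_min t1 divr_gt0//= gt_min t2.
move=> r'; rewrite inE => /orP[/eqP->|/ht h] r'0.
  by rewrite gt_min ltr_pdivrMr// mulr_natr mulr2n ltrDl r0 orbT.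
by rewrite gt_min h.
Qed.

End seq_extrema.

Section generic_perturbation.
Context {R : realType} {d : nat}.

(** If the current point lies on the hyperplane orthogonal to [l], it is moved along [l] itself,
    which leaves that hyperplane at once. Each other hyperplane is met for at most one parameter
    [t], and [t] is taken below all positive parameters of this kind. *)
Lemma generic_vector_near (L : seq 'cV[R]_d) (z : 'cV[R]_d) (eta : R) :
  0 < eta -> (forall l, l \in L -> l != 0) ->
  exists2 z', enorm (z' - z) < eta & forall l, l \in L -> inner l z' != 0.
Proof.
move=> eta0; elim: L => [|l L IH] Ln0.
  by exists z => //; rewrite subrr (_ : enorm _ = 0)//; apply/eqP; rewrite enorm_eq0.
have [l' l'L|z1 z1z hz1] := IH _; first by apply: Ln0; rewrite inE l'L orbT.
have [lz1|lz1] := eqVneq (inner l z1) 0; last first.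
  by exists z1 => // l'; rewrite inE => /orP[/eqP->//|/hz1].
have ln0 : l != 0 by apply: Ln0; rewrite inE eqxx.
have el : 0 < enorm l by rewrite lt_neqAle eq_sym enorm_eq0 ln0 enorm_ge0.
have gap : 0 < (eta - enorm (z1 - z)) / enorm l by rewrite divr_gt0// subr_gt0.
have [t /andP[t0 tgap] ht] := exists_below_positives
  [seq - inner l' z1 / inner l' l | l' <- L] gap.
exists (z1 + t *: l).
  rewrite addrAC; apply: le_lt_trans (enorm_triangle _ _) _.
  by rewrite enormZ ?ltW// -ltrBrDl -ltr_pdivlMr.
move=> l'; rewrite inE innerDr innerZr => /orP[/eqP->|l'L].
  by rewrite lz1 add0r mulf_neq0 ?inner_eq0// gt_eqF.
have [->|l'l] := eqVneq (inner l' l) 0; first by rewrite mulr0 addr0 hz1.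
apply/eqP => e; have tE : t = - inner l' z1 / inner l' l.
  by apply: (mulIf l'l); rewrite divfK//; apply/eqP; rewrite -subr_eq0 opprK addrC e.
have /ht : - inner l' z1 / inner l' l \in [seq - inner l' z1 / inner l' l | l' <- L].
  exact: (map_f (fun l' => - inner l' z1 / inner l' l)).
by rewrite -tE ltxx => /(_ t0).
Qed.

End generic_perturbation.

Section max_filter.
Context {R : realType} {d : nat} (G : seq 'M[R]_d).
Hypothesis hG : is_fin_orth_group G.
Implicit Types (g h : 'M[R]_d) (x y z w : 'cV[R]_d).

Lemma group_mulVmx g : g \in G -> g^T *m g = 1%:M.
Proof. by case: hG => _ _ _ GO gG; apply: mulmx1C; exact: GO. Qed.

(** Left multiplication by [g] is injective on the finite list [G], hence onto, so it reaches the
    identity; the preimage is the inverse [g^T]. *)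
Lemma group_trmx g : g \in G -> g^T \in G.
Proof.
move=> gG; have [uG G1 GM GO] := hG.
have inj : injective (mulmx g : 'M[R]_d -> 'M[R]_d).
  by move=> a b /(congr1 (mulmx g^T)); rewrite !mulmxA group_mulVmx// !mul1mx.
have sub : {subset [seq g *m h | h <- G] <= G} by move=> _ /mapP[h hG' ->]; exact: GM.
have u : uniq [seq g *m h | h <- G] by rewrite map_inj_uniq.
have [_ e] := uniq_min_size u sub (eq_leq (esym (size_map _ _))).
have : 1%:M \in [seq g *m h | h <- G] by rewrite e.
move=> /mapP[h hG' e1]; rewrite (_ : g^T = h)//.
by rewrite -[g^T]mulmx1 e1 mulmxA group_mulVmx// mul1mx.
Qed.

Lemma inner_group g x y : g \in G -> inner (g *m x) (g *m y) = inner x y.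
Proof. by move=> gG; rewrite inner_mulmxl mulmxA group_mulVmx// mul1mx. Qed.

Lemma enorm_group g x : g \in G -> enorm (g *m x) = enorm x.
Proof. by move=> gG; apply: enorm_orth; exact: group_mulVmx. Qed.

Lemma group1 : 1%:M \in G. Proof. by case: hG. Qed.

Lemma groupM g h : g \in G -> h \in G -> g *m h \in G.
Proof. by case: hG => _ _ + _; apply. Qed.

Lemma maxfilter_ge2 g h z x : g \in G -> h \in G ->
  inner (g *m z) (h *m x) <= maxfilter G z x.
Proof.
move=> gG hG'; apply: le_trans (bigmaxr_ge _ _ gG).
exact: (@bigmaxr_ge _ _ G (fun h => inner (g *m z) (h *m x)) _ h hG').
Qed.

Lemma maxfilter_ge g z x : g \in G -> inner (g *m z) x <= maxfilter G z x.
Proof. by move=> gG; rewrite -{1}[x]mul1mx; apply: maxfilter_ge2 => //; exact: group1. Qed.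

(** Orthogonality moves [h] from [x] to the template, so one group element is enough to realize the
    double maximum. *)
Lemma maxfilter_attained z x :
  exists2 g, g \in G & maxfilter G z x = inner (g *m z) x.
Proof.
have base : exists2 g, g \in G & inner z x = inner (g *m z) x.
  by exists 1%:M; [exact: group1|rewrite mul1mx].
rewrite /maxfilter.
have [->//|[g gG ->]] := bigmaxr_attained G
  (fun g => \big[Num.max/inner z x]_(h <- G) inner (g *m z) (h *m x)) (inner z x).
have [->//|[h hG' ->]] := bigmaxr_attained G
  (fun h => inner (g *m z) (h *m x)) (inner z x).
exists (h^T *m g); first by apply: groupM => //; exact: group_trmx.
by rewrite -mulmxA [RHS]inner_mulmxl trmxK.
Qed.

Lemma maxfilter_ge_r g z x : g \in G -> inner (g *m x) z <= maxfilter G z x.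
Proof.
by move=> gG; rewrite innerC -{1}[z]mul1mx; apply: maxfilter_ge2 => //; exact: group1.
Qed.

Lemma maxfilter_attained_r z x :
  exists2 g, g \in G & maxfilter G z x = inner (g *m x) z.
Proof.
have [g gG ->] := maxfilter_attained z x; exists g^T; first exact: group_trmx.
by rewrite inner_mulmxl innerC.
Qed.

Lemma maxfilter_group g z x : g \in G -> maxfilter G z (g *m x) = maxfilter G z x.
Proof.
move=> gG; apply/le_anti/andP; split.
  have [h hG' ->] := maxfilter_attained z (g *m x).
  exact: maxfilter_ge2.
have [h hG' ->] := maxfilter_attained z x.
rewrite -(inner_group _ _ gG) mulmxA; apply: maxfilter_ge; exact: groupM.
Qed.

Lemma orbit_dist_le g h x y : g \in G -> h \in G ->
  orbit_dist G x y <= enorm (g *m x - h *m y).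
Proof.
move=> gG hG'; apply: le_trans (bigminr_le _ _ gG) _.
exact: (@bigminr_le _ _ G (fun h => enorm (g *m x - h *m y)) _ h hG').
Qed.

Lemma orbit_dist_attained x y : exists g h,
  [/\ g \in G, h \in G & orbit_dist G x y = enorm (g *m x - h *m y)].
Proof.
have base : exists g h, [/\ g \in G, h \in G & enorm (x - y) = enorm (g *m x - h *m y)].
  by exists 1%:M, 1%:M; rewrite !mul1mx; split => //; exact: group1.
rewrite /orbit_dist.
have [->//|[g gG ->]] := bigminr_attained G
  (fun g => \big[Num.min/enorm (x - y)]_(h <- G) enorm (g *m x - h *m y)) (enorm (x - y)).
have [->//|[h hG' ->]] := bigminr_attained G
  (fun h => enorm (g *m x - h *m y)) (enorm (x - y)).
by exists g, h.
Qed.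

Lemma orbit_dist_perturb x y x' y' :
  orbit_dist G x y <= enorm (x' - x) + orbit_dist G x' y' + enorm (y' - y).
Proof.
have [g [h [gG hG' ->]]] := orbit_dist_attained x' y'.
apply: le_trans (orbit_dist_le x y gG hG') _.
have -> : g *m x - h *m y =
    g *m (x - x') + (g *m x' - h *m y') + h *m (y' - y).
  by rewrite !mulmxBr !addrA subrK addrNK.
apply: le_trans (enorm_triangle _ _) _.
rewrite (enorm_group _ hG') lerD2r; apply: le_trans (enorm_triangle _ _) _.
by rewrite (enorm_group _ gG) lerD2r -opprB enormN.
Qed.

(** Take [g] optimal for the larger of the two values; it is merely admissible for the smaller one.
    Squaring removes the dependence on which is larger. *)
Lemma maxfilter_sqr_diff z x y : exists2 g, g \in G &
  (maxfilter G z x - maxfilter G z y) ^+ 2 <= inner (g *m z) (x - y) ^+ 2.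
Proof.
have sq (a b : R) : 0 <= a -> a <= b -> a ^+ 2 <= b ^+ 2.
  by move=> a0 ab; rewrite ler_pXn2r// nnegrE// (le_trans a0).
have [xy|xy] := leP (maxfilter G z y) (maxfilter G z x).
  have [g gG e] := maxfilter_attained z x.
  exists g => //; apply: sq; first by rewrite subr_ge0.
  by rewrite innerBr e lerD2l lerN2; exact: maxfilter_ge.
have [g gG e] := maxfilter_attained z y.
exists g => //; rewrite -sqrrN -[leRHS]sqrrN; apply: sq.
  by rewrite opprB subr_ge0 ltW.
by rewrite innerBr !opprB e lerD2l lerN2; exact: maxfilter_ge.
Qed.

Section bank.
Variables (n : nat) (z : 'I_n -> 'cV[R]_d).

Lemma filter_bank_diff_sqr x y :
  enorm (filter_bank G z x - filter_bank G z y) ^+ 2 =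
  \sum_i (maxfilter G (z i) x - maxfilter G (z i) y) ^+ 2.
Proof.
by rewrite enorm_sqr; apply: eq_bigr => i _; rewrite !mxE expr2.
Qed.

(** Singular value bounds written as quadratic forms. The group element varies with the index
    because maximizers differ from template to template, and [frame_lower] ranges over all [I]
    because the set found by pigeonhole depends on the two points. *)
Definition frame_upper (b : R) := forall g : 'I_n -> 'M[R]_d,
  (forall i, g i \in G) -> forall u : 'cV[R]_d,
  \sum_i inner (g i *m z i) u ^+ 2 <= b ^+ 2 * inner u u.

Definition frame_lower (k : nat) (a : R) := forall I : {set 'I_n}, #|I| = k ->
  forall g : 'I_n -> 'M[R]_d, (forall i, g i \in G) -> forall u : 'cV[R]_d,
  a ^+ 2 * inner u u <= \sum_(i in I) inner (g i *m z i) u ^+ 2.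

Lemma filter_bank_enorm_le b x y : 0 <= b -> frame_upper b ->
  enorm (filter_bank G z x - filter_bank G z y) <= b * enorm (x - y).
Proof.
move=> b0 hb.
have /choice[g hg] : forall i, exists g, g \in G /\
  (maxfilter G (z i) x - maxfilter G (z i) y) ^+ 2 <= inner (g *m z i) (x - y) ^+ 2.
  by move=> i; have [g] := maxfilter_sqr_diff (z i) x y; exists g.
rewrite -(@ler_pXn2r _ 2)// ?nnegrE ?mulr_ge0 ?enorm_ge0//.
rewrite filter_bank_diff_sqr exprMn enorm_sqr.
apply: le_trans (hb g _ _); last by move=> i; exact: (hg i).1.
by apply: ler_sum => i _; exact: (hg i).2.
Qed.

Lemma filter_bank_group g x : g \in G -> filter_bank G z (g *m x) = filter_bank G z x.
Proof. by move=> gG; apply/colP => i; rewrite !mxE maxfilter_group. Qed.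

Lemma filter_bank_upper_lip b : 0 <= b -> frame_upper b ->
  upper_lip G (filter_bank G z) b.
Proof.
move=> b0 hb x y; have [g [h [gG hG' ->]]] := orbit_dist_attained x y.
rewrite -(filter_bank_group x gG) -(filter_bank_group y hG').
exact: filter_bank_enorm_le.
Qed.

(** A point fixed by [g != 1] is orthogonal to every row of [g - 1], one of which is nonzero; it
    suffices to avoid the finitely many hyperplanes so obtained. *)
Lemma principal_dense x (eta : R) : 0 < eta ->
  exists2 x', enorm (x' - x) < eta & principal G x'.
Proof.
move=> eta0.
pose L := [seq l <- [seq (row i (g - 1%:M))^T | g <- G, i <- enum 'I_d] | l != 0].
have [||x' x'x hx'] := @generic_vector_near _ _ L x eta => //.
  by move=> l; rewrite mem_filter => /andP[].
exists x' => // g gG gx'; apply/eqP; rewrite -subr_eq0; apply/negP => /negP gn0.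
have [i ri] : exists i, row i (g - 1%:M) != 0.
  apply/existsP; apply: contraNT gn0 => /existsPn h.
  by apply/eqP/row_matrixP => i; rewrite row0; apply/eqP; rewrite -[_ == _]negbK h.
have : (row i (g - 1%:M))^T \in L.
  rewrite mem_filter trmx_eq0 ri; apply/allpairsP; exists (g, i).
  by rewrite mem_enum.
move=> /hx'; rewrite inner_mxE trmxK -row_mul mulmxBl mul1mx gx' subrr row0 mxE.
by rewrite eqxx.
Qed.

Lemma voronoi_group g p w : g \in G -> voronoi G p w -> voronoi G (g *m p) (g *m w).
Proof.
move=> gG v q /mapP[h hG' ->] qp.
have e : inner (h *m (g *m p)) (g *m w) = inner (g^T *m h *m g *m p) w.
  by rewrite -!mulmxA [in RHS]inner_mulmxl trmxK.
rewrite e inner_group//; apply: v.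
  by apply: map_f; rewrite -mulmxA; apply: groupM; [exact: group_trmx|exact: groupM].
apply: contra_neq qp => /(congr1 (mulmx g)); rewrite !mulmxA.
by case: hG => _ _ _ GO; rewrite GO// mul1mx.
Qed.

Lemma gap_below (s : seq R) (M : R) : exists2 e, 0 < e &
  forall r, r \in s -> M - e < r -> M <= r.
Proof.
elim: s => [|r s [e e0 h]]; first by exists 1.
have [rM|rM] := leP M r.
  by exists e => // r'; rewrite inE => /orP[/eqP->|/h].
exists (Num.min e (M - r)); first by rewrite lt_min e0 subr_gt0.
move=> r'; rewrite inE => /orP[/eqP->|r's].
  by rewrite ltrBlDl -ltrBlDr lt_min ltxx andbF.
by rewrite ltrBlDr -ltrBlDl => /lt_le_trans h'; apply: h => //;
   rewrite ltrBlDr -ltrBlDl; apply: h'; rewrite ge_min lexx.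
Qed.

(** Ties at [z0] are broken by the perturbation: the winner at [z'] is unique, and it is within [e]
    of the maximum at [z0], hence equal to it by the choice of the gap [e]. *)
Lemma generic_maximizer z0 x : exists2 eta, 0 < eta &
  forall z', enorm (z' - z0) < eta ->
  (forall p q, p \in Defs.orbit G x -> q \in Defs.orbit G x -> p != q -> inner (p - q) z' != 0) ->
  exists2 h, h \in G & voronoi G (h *m x) z' /\ maxfilter G z0 x = inner (h *m x) z0.
Proof.
have [e e0 he] := gap_below [seq inner (h *m x) z0 | h <- G] (maxfilter G z0 x).
have x1 : 0 < enorm x + 1 by rewrite ltr_wpDl ?enorm_ge0.
(* Within this radius each inner product with the orbit moves by less than [e / 2]; the [+ 1] covers
   [x = 0]. *)
exists (e / 2 / (enorm x + 1)); first by rewrite !divr_gt0.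
move=> z' zz gen.
have small h : h \in G -> `|inner (h *m x) z' - inner (h *m x) z0| < e / 2.
  move=> hG'; rewrite -innerBr; apply: le_lt_trans (inner_le_enorm _ _) _.
  rewrite enorm_group//; apply: (@le_lt_trans _ _ ((enorm x + 1) * enorm (z' - z0))).
    by rewrite ler_wpM2r ?enorm_ge0// lerDl.
  by rewrite mulrC -ltr_pdivlMr.
have [h hG' hm] := maxfilter_attained_r z' x.
exists h => //; split.
  move=> q /mapP[g gG ->] qp; rewrite lt_neqAle -{2}hm mulmxA.
  rewrite (maxfilter_ge_r _ _ (groupM gG hG')) andbT -subr_eq0 -innerBl.
  have o g' : g' \in G -> g' *m x \in Defs.orbit G x.
    exact: (map_f (fun g => g *m x)).
  by apply: gen; [exact: o (groupM gG hG')|exact: o|rewrite -mulmxA].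
apply/le_anti/andP; split; last exact: maxfilter_ge_r.
apply: he; first exact: (map_f (fun h => inner (h *m x) z0)).
have [h0 h0G ->] := maxfilter_attained_r z0 x.
have := small h hG'; have := small h0 h0G; rewrite !ltr_norml => /andP[a1 a2] /andP[b1 b2].
have := maxfilter_ge_r z' x h0G; rewrite hm; lra.
Qed.

End bank.
End max_filter.

Lemma subset_of_card (T : finType) (A : {set T}) k :
  (k <= #|A|)%N -> exists2 B : {set T}, B \subset A & #|B| = k.
Proof.
move=> kA; exists [set x in take k (enum A)]%SET.
  by apply/fintype.subsetP => x; rewrite inE => /mem_take; rewrite mem_enum.
rewrite cardsE; have /card_uniqP -> : uniq (take k (enum A)) by rewrite take_uniq ?enum_uniq.
by rewrite size_take -cardE; move: kA; rewrite leq_eqVlt => /orP[/eqP->|->//]; rewrite ltnn.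
Qed.

Lemma pigeonhole_seq (T : eqType) n (S : seq T) (f : 'I_n -> T) (k : nat) :
  uniq S -> (forall i, f i \in S) -> (size S * k < n)%N ->
  exists2 w, w \in S & (k < #|[set i | f i == w]%SET|)%N.
Proof.
move=> uS fS lt.
have [/hasP[w wS hw]|/hasPn h] := boolP (has (fun w => k < #|[set i | f i == w]%SET|)%N S).
  by exists w.
move: lt; rewrite ltnNge; have -> // : (n <= size S * k)%N.
have -> : n = (\sum_(w <- S) #|[set i | f i == w]%SET|)%N.
  transitivity (\sum_(i < n) 1)%N; first by rewrite sum1_card card_ord.
  transitivity (\sum_(i < n) \sum_(w <- S) (f i == w))%N.
    apply: eq_bigr => i _.
    by rewrite (bigD1_seq (f i))//= eqxx big1// => w; rewrite eq_sym => /negbTE ->.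
  rewrite exchange_big; apply: eq_bigr => w _.
  by rewrite -sum1dep_card [RHS]big_mkcond; apply: eq_bigr => i _; case: eqP.
apply: (@leq_trans (\sum_(w <- S) k)).
  by rewrite big_seq [leqRHS]big_seq; apply: leq_sum => w /h; rewrite -leqNgt.
by rewrite big_const_seq count_predT iter_addn addn0 mulnC.
Qed.

(** * Lower Lipschitz bound through common points of Voronoi cells *)

Section lower_bound.
Context {R : realType} {d : nat} (G : seq 'M[R]_d).
Hypothesis hG : is_fin_orth_group G.
Implicit Types (g h : 'M[R]_d) (x y w : 'cV[R]_d).

(** A single perturbation has to serve both orbits, since [Sxy] asks for a point common to two
    cells; hence the smaller radius and the joint list of differences. *)
Lemma common_voronoi_maximizers z0 x y : exists h h' z',
  [/\ h \in G, h' \in G, voronoi G (h *m x) z', voronoi G (h' *m y) z' &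
      maxfilter G z0 x = inner (h *m x) z0 /\ maxfilter G z0 y = inner (h' *m y) z0].
Proof.
have [e1 e10 H1] := generic_maximizer hG z0 x.
have [e2 e20 H2] := generic_maximizer hG z0 y.
pose D v := [seq p - q | p <- Defs.orbit G v, q <- Defs.orbit G v].
pose L := [seq l <- D x ++ D y | l != 0].
have e0 : 0 < Num.min e1 e2 by rewrite lt_min e10.
have [|z' z'z gen] := @generic_vector_near _ _ L z0 _ e0.
  by move=> l; rewrite mem_filter => /andP[].
have inD v p q : p \in Defs.orbit G v -> q \in Defs.orbit G v -> p - q \in D v.
  by move=> pG qG; apply/allpairsP; exists (p, q).
have [||h hG' [v1 m1]] := H1 z'.
- by move: z'z; rewrite lt_min => /andP[].
- move=> p q pG qG pq; apply: gen.
  by rewrite mem_filter subr_eq0 pq mem_cat inD.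
have [||h' hG'' [v2 m2]] := H2 z'.
- by move: z'z; rewrite lt_min => /andP[].
- move=> p q pG qG pq; apply: gen.
  by rewrite mem_filter subr_eq0 pq mem_cat (inD y) ?orbT.
by exists h, h', z'.
Qed.

Lemma size_Sxy_le x y : principal G x -> principal G y ->
  (size (Sxy G x y) <= chiG G)%N.
Proof.
move=> px py.
have sG : (size (Sxy G x y) < (size G).+1)%N.
  rewrite ltnS size_filter; apply: leq_trans (count_size _ _) _.
  by apply: leq_trans (size_undup _) _; rewrite size_map.
rewrite /chiG.
apply: (@leq_bigmax_cond _ _ (fun k : 'I_(size G).+1 => val k) (Ordinal sG)).
by apply/asboolP; exists x, y.
Qed.

Lemma maxfilter_diff_Sxy z0 x y : exists g w, [/\ g \in G, w \in Sxy G x y &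
  maxfilter G z0 x - maxfilter G z0 y = inner (g *m z0) (x - w)].
Proof.
have [h [h' [z' [hG' hG'' v1 v2 [m1 m2]]]]] := common_voronoi_maximizers z0 x y.
have hT := group_trmx hG hG'.
(* [h^T] inverts [h]: it carries the cell of [h *m x] to that of [x], and [z'] to a point of both
   cells in question. *)
exists h^T, (h^T *m (h' *m y)); split => //.
  rewrite mem_filter mem_undup; apply/andP; split.
    apply/asboolP; exists (h^T *m z'); split; first exact: voronoi_group.
    by have := voronoi_group hG hT v1; rewrite mulmxA (group_mulVmx hG)// mul1mx.
  by rewrite mulmxA; apply: map_f; exact: groupM.
rewrite m1 m2 -innerBl innerC [in RHS]inner_mulmxl trmxK mulmxBr; congr inner.
by rewrite !mulmxA; case: hG => _ _ _ GO; rewrite GO// mul1mx.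
Qed.

Section bank.
Variables (n k : nat) (z : 'I_n -> 'cV[R]_d) (a b : R).
Hypotheses (a0 : 0 <= a) (b0 : 0 <= b).
Hypotheses (ub : frame_upper G z b) (lb : frame_lower G z k.+1 a).
Hypothesis chik : (chiG G * k < n)%N.

Lemma filter_bank_lower_principal x y : principal G x -> principal G y ->
  a * orbit_dist G x y <= enorm (filter_bank G z x - filter_bank G z y).
Proof.
move=> px py.
have /choice[gw hgw] : forall i, exists gw : 'M[R]_d * 'cV[R]_d,
   [/\ gw.1 \in G, gw.2 \in Sxy G x y &
   maxfilter G (z i) x - maxfilter G (z i) y = inner (gw.1 *m z i) (x - gw.2)].
  by move=> i; have [g [w ?]] := maxfilter_diff_Sxy (z i) x y; exists (g, w).
have [|||w wS] := @pigeonhole_seq _ n (Sxy G x y) (fun i => (gw i).2) k.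
- by rewrite filter_uniq// undup_uniq.
- by move=> i; case: (hgw i).
- by apply: leq_ltn_trans chik; rewrite leq_mul2r size_Sxy_le ?orbT.
move=> /subset_of_card[I IA cI].
have [h hG' wE] : exists2 h, h \in G & w = h *m y.
  by move: wS; rewrite mem_filter mem_undup => /andP[_ /mapP].
(* [w] lies in the orbit of [y], so the orbit distance is at most [enorm (x - w)]. *)
apply: (@le_trans _ _ (a * enorm (x - w))).
  apply: ler_wpM2l => //; rewrite wE.
  by have := orbit_dist_le x y (group1 hG) hG'; rewrite mul1mx.
rewrite -(@ler_pXn2r _ 2)// ?nnegrE ?mulr_ge0 ?enorm_ge0//.
rewrite filter_bank_diff_sqr exprMn enorm_sqr.
apply: le_trans (lb cI (g := fun i => (gw i).1) _ _) _.
  by move=> i; case: (hgw i).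
rewrite [leRHS](bigID (mem I)) /= -[leLHS]addr0; apply: lerD; last first.
  by apply: sumr_ge0 => i _; exact: sqr_ge0.
apply: ler_sum => i iI; have [_ _ ->] := hgw i.
by move: (fintype.subsetP IA _ iI); rewrite inE => /eqP ->.
Qed.

Lemma filter_bank_lower_lip : lower_lip G (filter_bank G z) a.
Proof.
move=> x y; apply/ler_addgt0Pr => e e0.
(* Moving both points by less than [eta] costs at most [2 a eta] on the left and [2 b eta] on the
   right; the [+ 1] keeps [c] positive. *)
pose c := 2 * (a + b) + 1.
have c0 : 0 < c by rewrite ltr_wpDl// mulr_ge0// addr_ge0.
have eta0 : 0 < e / c by rewrite divr_gt0.
have [x' xx px] := principal_dense G x eta0.
have [y' yy py] := principal_dense G y eta0.
have h1 := filter_bank_lower_principal px py.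
have h2 := orbit_dist_perturb hG x y x' y'.
have h3 := filter_bank_enorm_le hG x' x b0 ub.
have h4 := filter_bank_enorm_le hG y y' b0 ub.
have yy' : enorm (y - y') < e / c by rewrite -opprB enormN.
have h5 : enorm (filter_bank G z x' - filter_bank G z y') <=
   enorm (filter_bank G z x' - filter_bank G z x) +
   enorm (filter_bank G z x - filter_bank G z y) +
   enorm (filter_bank G z y - filter_bank G z y').
  apply: le_trans _ (lerD (enorm_triangle _ _) (lexx _)).
  apply: le_trans _ (enorm_triangle _ _).
  by rewrite !addrA !subrK.
have ax := ler_wpM2l a0 (ltW xx).
have ay := ler_wpM2l a0 (ltW yy).
have bx := ler_wpM2l b0 (ltW xx).
have by_ := ler_wpM2l b0 (ltW yy').
have ec : e / c * c = e by rewrite divfK// gt_eqF.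
have h6 := ler_wpM2l a0 h2.
move: ec; rewrite /c; nra.
Qed.

End bank.
End lower_bound.

(** * Distortion and nets *)

Lemma distortion_le (R : realType) (d n : nat) (G : seq 'M[R]_d)
    (f : 'cV[R]_d -> 'cV[R]_n) (a b : R) :
  0 < a -> 0 <= b -> lower_lip G f a -> upper_lip G f b ->
  (distortion G f <= (b / a)%:E)%E.
Proof.
move=> a0 b0 la ub; rewrite /distortion.
have aA : (a%:E <= lip_alpha G f)%E.
  by apply: ereal_sup_ubound; exists a => //; split => //; exact: ltW.
have bB : (lip_beta G f <= b%:E)%E by apply: ereal_inf_lbound; exists b.
have B0 : (0 <= lip_beta G f)%E.
  by apply/ereal_infP => _ [b' [b'0 _] <-]; rewrite lee_fin.
have -> /= : (lip_alpha G f == 0%E) = false.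
  by apply/negbTE; rewrite gt_eqF// (lt_le_trans _ aA)// lte_fin.
have -> /= : (lip_beta G f == +oo%E) = false.
  by apply/negbTE; rewrite lt_eqF// (le_lt_trans bB)// ltry.
(* Infinite [alpha] is assigned distortion 0 by definition. *)
case: eqP => [_|/eqP aoo]; first by rewrite lee_fin divr_ge0// ltW.
have aE : lip_alpha G f = (fine (lip_alpha G f))%:E.
  by rewrite fineK// fin_numE aoo andbT gt_eqF// (lt_le_trans _ aA)// ltNyr.
have bE : lip_beta G f = (fine (lip_beta G f))%:E.
  by rewrite fineK// ge0_fin_numE// (le_lt_trans bB)// ltry.
move: aA bB B0; rewrite aE bE !lee_fin /= => aA bB B0.
have A0 := lt_le_trans a0 aA.
by rewrite ler_pM// ?invr_ge0 ?(ltW A0)// lef_pV2.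
Qed.

Section net.
Context {R : realType}.

(** Rational enclosures of [e] from [1 + t <= expR t] at [t = 1/8] and [t = -1/8], raised to the
    eighth power. *)
Lemma expR1_ge : 51 / 20 <= expR 1 :> R.
Proof.
have -> : (1 : R) = 8%:R * (1 / 8) by field.
rewrite expRM_natl; apply: (@le_trans _ _ ((1 + 1 / 8) ^+ 8)); first by lra.
by rewrite ler_pXn2r ?nnegrE ?expR_ge0 ?expR_ge1Dx//; lra.
Qed.

Lemma expR1_le : expR 1 <= 3 :> R.
Proof.
rewrite -[leRHS]invrK -[leLHS]invrK -expRN lef_pV2 ?posrE ?expR_gt0//.
have -> : (-1 : R) = 8%:R * (- 1 / 8) by field.
rewrite expRM_natl; apply: (@le_trans _ _ ((1 + (- 1 / 8)) ^+ 8)); first by lra.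
by rewrite ler_pXn2r ?nnegrE ?expR_ge0 ?expR_ge1Dx//; lra.
Qed.

Lemma geometric_sum_expRN (delta : R) K : 0 < delta ->
  \sum_(i < K) expR (- delta) ^+ i <= (1 + delta) / delta.
Proof.
move=> d0; set q := expR (- delta).
have q0 : 0 <= q by exact: expR_ge0.
have qe : q * (1 + delta) <= 1.
  by rewrite -ler_pdivlMl ?expR_gt0// /q expRN invrK mulr1 expR_ge1Dx.
have e := subrX1 q K.
have : (1 - q) * \sum_(i < K) q ^+ i <= 1.
  rewrite -opprB mulNr -e opprB lerBlDr lerDl; exact: exprn_ge0.
have s0 : 0 <= \sum_(i < K) q ^+ i by apply: sumr_ge0 => i _; exact: exprn_ge0.
move=> h; rewrite ler_pdivlMr//.
have : delta <= (1 - q) * (1 + delta) by lra.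
move=> /(ler_wpM2l s0) h2; apply: le_trans h2 _.
by rewrite mulrA (mulrC _ (1 - q)) ler_piMl//; lra.
Qed.

(** Coordinates are rounded towards zero to multiples of [delta / sqrt d]: norms do not grow and the
    total error is at most [delta]. Only grid points of small l1 norm are kept, because counting the
    full cube would cost an extra factor of order [d ^ (d / 2)]. *)
Lemma exists_net (d : nat) (delta : R) : (0 < d)%N -> 0 < delta <= 1 / 10 ->
  exists2 N : seq 'cV[R]_d, (size N)%:R <= (expR 2 / delta) ^+ d &
  forall u : 'cV[R]_d, inner u u = 1 ->
    exists u', [/\ u' \in N, enorm u' <= 1 & enorm (u - u') <= delta].
Proof.
move=> dpos /andP[delta0 delta1].
have d0 : 0 < d%:R :> R by rewrite ltr0n.
have sd0 : 0 < Num.sqrt d%:R :> R by rewrite sqrtr_gt0.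
have sd2 : Num.sqrt d%:R * Num.sqrt d%:R = d%:R :> R by rewrite -expr2 sqr_sqrtr// ltW.
pose c := delta / Num.sqrt d%:R.
have c0 : 0 < c by rewrite divr_gt0.
pose K := Num.truncn c^-1.
pose F := {ffun 'I_d -> bool * 'I_K.+1}.
pose vec (f : F) : 'cV[R]_d := \col_j ((-1) ^+ (f j).1 * ((f j).2%:R * c)).
pose ok (f : F) := \sum_j ((f j).2%:R : R) <= d%:R / delta.
exists [seq vec f | f <- enum ok].
  rewrite size_map -cardE.
  (* Each kept point has total weight [exp (d - delta * sum of its coordinates) >= 1], so the sum of
     all weights, which factors over coordinates, bounds their number. *)
  pose wt (a : bool * 'I_K.+1) : R := expR 1 * expR (- delta) ^+ a.2.
  apply: (@le_trans _ _ (\sum_(f : F) \prod_j wt (f j))).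
    rewrite -sum1_card natr_sum [leLHS]big_mkcond; apply: ler_sum => f _.
    have wt0 : 0 <= \prod_j wt (f j).
      by apply: prodr_ge0 => j _; rewrite mulr_ge0 ?exprn_ge0 ?expR_ge0.
    case: ifP => // okf.
    under eq_bigr do rewrite /wt -expRM_natr -expRD.
    rewrite -expR_sum -[leLHS]expR0 ler_expR big_split /= sumr_const card_ord.
    rewrite -mulr_sumr mulNr subr_ge0 -ler_pdivlMl//.
    by rewrite mulrC; exact: okf.
  rewrite -(bigA_distr_bigA (fun=> wt)) prodr_const card_ord.
  rewrite ler_pXn2r// ?nnegrE ?divr_ge0 ?expR_ge0 ?(ltW delta0)//; last first.
    by apply: sumr_ge0 => a _; rewrite mulr_ge0 ?exprn_ge0 ?expR_ge0.
  have -> : \sum_a wt a = 2 * expR 1 * \sum_(i < K.+1) expR (- delta) ^+ i.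
    rewrite -(pair_bigA _ (fun (b : bool) (i : 'I_K.+1) => wt (b, i))) /=.
    by rewrite big_bool /wt /= -mulr_sumr; ring.
  apply: le_trans (ler_wpM2l _ (geometric_sum_expRN _ delta0)) _.
    by rewrite mulr_ge0// expR_ge0.
  have -> : (2 : R) = 1 + 1 by [].
  rewrite [in leRHS]expRD mulrA ler_pM2r ?invr_gt0//.
  have := expR1_ge; have := expR_gt0 (1 : R); nra.
move=> u u1.
have uj j : `|u j 0| <= 1.
  rewrite -(@ler_pXn2r _ 2)// ?nnegrE// expr1n real_normK ?num_real// -u1 /inner.
  rewrite (bigD1 j)//= expr2 lerDl; apply: sumr_ge0 => i _.
  by rewrite -expr2 sqr_ge0.
pose t j := Num.truncn (`|u j 0| / c).
have tK j : (t j < K.+1)%N.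
  by rewrite ltnS; apply: le_truncn; rewrite -[leRHS]mul1r ler_pM2r// invr_gt0.
pose f : F := [ffun j => (u j 0 < 0, inord (t j))].
have tc j : (t j)%:R * c <= `|u j 0| /\ `|u j 0| <= (t j)%:R * c + c.
  have /andP[h1 h2] : (t j)%:R <= `|u j 0| / c < (t j).+1%:R.
    by apply: truncn_itv; rewrite divr_ge0// ltW.
  split; first by rewrite -ler_pdivlMr.
  by move: (ltW h2); rewrite ler_pdivrMr// -natr1 mulrDl mul1r.
have fE j : vec f j 0 = (-1) ^+ (u j 0 < 0)%R * ((t j)%:R * c).
  by rewrite mxE ffunE /= inordK.
exists (vec f); split.
- apply: map_f; rewrite mem_enum unfold_in /ok.
  (* Cauchy-Schwarz against the all-ones vector bounds the l1 norm of a unit vector, so its rounding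
     passes the test [ok]. *)
  have : \sum_j `|u j 0| <= Num.sqrt d%:R.
    rewrite -(@ler_pXn2r _ 2)// ?nnegrE ?(ltW sd0) ?sumr_ge0//.
    have := cauchy_schwarz (\col_j `|u j 0|) (const_mx 1 : 'cV[R]_d).
    have -> : inner (\col_j `|u j 0|) (const_mx 1 : 'cV[R]_d) = \sum_j `|u j 0|.
      by apply: eq_bigr => j _; rewrite !mxE mulr1.
    have -> : inner (\col_j `|u j 0|) (\col_j `|u j 0|) = 1.
      by rewrite -u1; apply: eq_bigr => j _; rewrite !mxE -expr2 real_normK ?num_real.
    have -> : inner (const_mx 1 : 'cV[R]_d) (const_mx 1) = d%:R.
      rewrite /inner; under eq_bigr do rewrite !mxE mulr1.
      by rewrite sumr_const card_ord.
    by rewrite mul1r sqr_sqrtr// ltW.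
  move=> h; rewrite ler_pdivlMr//.
  have -> : delta = c * Num.sqrt d%:R by rewrite /c divfK// gt_eqF.
  rewrite mulrA -[leRHS]sd2 ler_pM2r//; apply: le_trans h.
  rewrite mulr_suml; apply: ler_sum => j _.
  by rewrite ffunE /= inordK//; case: (tc j).
- rewrite -(@ler_pXn2r _ 2)// ?nnegrE ?enorm_ge0// expr1n enorm_sqr -u1.
  apply: ler_sum => j _; rewrite -!expr2 fE exprMn sqrr_sign mul1r.
  rewrite -[leRHS]real_normK ?num_real// ler_pXn2r// ?nnegrE ?normr_ge0
    ?(mulr_ge0 (ler0n _ _) (ltW c0))//.
  by case: (tc j).
- rewrite -(@ler_pXn2r _ 2)// ?nnegrE ?enorm_ge0 ?(ltW delta0)// enorm_sqr.
  apply: (@le_trans _ _ (\sum_(j < d) c ^+ 2)).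
    apply: ler_sum => j _; rewrite -expr2 2!mxE fE [X in X - _]numEsign -mulrBr.
    rewrite exprMn sqrr_sign mul1r; have [h1 h2] := tc j.
    by rewrite ler_pXn2r// ?nnegrE ?subr_ge0 ?(ltW c0)// lerBlDl.
  rewrite sumr_const card_ord /c expr_div_n sqr_sqrtr ?(ltW d0)// -[leLHS]mulr_natr.
  by rewrite divfK// gt_eqF.
Qed.

End net.

Section net_frames.
Context {R : realType} {n d : nat} (a : 'I_n -> 'cV[R]_d).

Definition analysis (u : 'cV[R]_d) : 'cV[R]_n := \col_i inner (a i) u.

Lemma enorm_analysis_sqr u : enorm (analysis u) ^+ 2 = \sum_i inner (a i) u ^+ 2.
Proof. by rewrite enorm_sqr; apply: eq_bigr => i _; rewrite mxE expr2. Qed.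

Lemma analysisD u v : analysis (u + v) = analysis u + analysis v.
Proof. by apply/colP => i; rewrite !mxE innerDr. Qed.

Lemma analysisZ (t : R) u : analysis (t *: u) = t *: analysis u.
Proof. by apply/colP => i; rewrite !mxE innerZr. Qed.

(** A crude a priori bound, without which the supremum in the net argument would not be
    meaningful. *)
Lemma analysis_bounded : exists M : R, forall u, inner u u = 1 -> enorm (analysis u) <= M.
Proof.
exists (Num.sqrt (\sum_i inner (a i) (a i))) => u u1.
rewrite -[leLHS]ger0_norm ?enorm_ge0// -sqrtr_sqr ler_wsqrtr// enorm_analysis_sqr.
by apply: ler_sum => i _; apply: le_trans (cauchy_schwarz _ _) _; rewrite u1 mulr1.
Qed.

Lemma analysis_le_of_unit (M : R) :
  (forall u, inner u u = 1 -> enorm (analysis u) <= M) ->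
  forall u, enorm (analysis u) <= M * enorm u.
Proof.
move=> hM u; have [->|u0] := eqVneq u 0.
  have -> : analysis 0 = 0 by rewrite -[X in analysis X](scale0r 0) analysisZ scale0r.
  have e0 k : enorm (0 : 'cV[R]_k) = 0 by apply/eqP; rewrite enorm_eq0.
  by rewrite !e0 mulr0.
have eu : 0 < enorm u by rewrite lt_neqAle eq_sym enorm_eq0 u0 enorm_ge0.
have := hM ((enorm u)^-1 *: u).
rewrite innerZl innerZr mulrA -expr2 -enorm_sqr -exprMn mulVf ?gt_eqF// expr1n.
move=> /(_ erefl); rewrite analysisZ enormZ ?invr_ge0 ?(ltW eu)// => h.
by rewrite -ler_pdivrMr// mulrC.
Qed.

Variables (N : seq 'cV[R]_d) (delta : R).
Hypothesis delta01 : 0 < delta < 1.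
Hypothesis netN : forall u : 'cV[R]_d, inner u u = 1 ->
  exists u', [/\ u' \in N, enorm u' <= 1 & enorm (u - u') <= delta].

(* The supremum M over the sphere satisfies M <= c + delta M. *)
Lemma net_frame_upper (c : R) : 0 <= c ->
  (forall u, u \in N -> \sum_i inner (a i) u ^+ 2 <= c ^+ 2 * inner u u) ->
  forall u, \sum_i inner (a i) u ^+ 2 <= (c / (1 - delta)) ^+ 2 * inner u u.
Proof.
move=> c0 hN u.
have /andP[delta0 delta1] := delta01.
have hN' v : v \in N -> enorm (analysis v) <= c * enorm v.
  move=> /hN h; rewrite -(@ler_pXn2r _ 2)// ?nnegrE ?mulr_ge0 ?enorm_ge0//.
  by rewrite enorm_analysis_sqr exprMn enorm_sqr.
pose S := [set enorm (analysis v) | v in [set v : 'cV[R]_d | inner v v = 1]].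
have [M0 hM0] := analysis_bounded.
have bS : has_ubound S by exists M0 => _ [v v1 <-]; exact: hM0.
have hM v : inner v v = 1 -> enorm (analysis v) <= sup S.
  by move=> v1; apply: ub_le_sup => //; exists v.
have hM' := analysis_le_of_unit hM.
suff key v : inner v v = 1 -> enorm (analysis v) <= c / (1 - delta).
  have := analysis_le_of_unit key u => h.
  rewrite -enorm_analysis_sqr -enorm_sqr -exprMn ler_pXn2r ?nnegrE ?enorm_ge0//.
  exact: le_trans (enorm_ge0 _) h.
move=> v1; apply: le_trans (hM v v1) _.
have S0 : S !=set0 by exists (enorm (analysis v)); exists v.
have M0' : 0 <= sup S by apply: le_trans (hM v v1); exact: enorm_ge0.
rewrite ler_pdivlMr ?subr_gt0// mulrBr mulr1 lerBlDr.
apply: ge_sup => // _ [w w1 <-].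
have [w' [w'N w'1 ww']] := netN w1.
have -> : w = w' + (w - w') by rewrite addrC subrK.
rewrite analysisD; apply: le_trans (enorm_triangle _ _) _; apply: lerD.
  by apply: le_trans (hN' _ w'N) _; rewrite ler_piMr.

by apply: le_trans (hM' _) _; rewrite ler_wpM2l.
Qed.

(** A net point [v'] near a unit vector has norm at least [1 - delta], and the displacement costs at
    most [b delta]; the upper bound is thus an input. *)
Lemma net_frame_lower (s b : R) : 0 <= s -> 0 <= b -> 0 <= s * (1 - delta) - b * delta ->
  (forall u, u \in N -> s ^+ 2 * inner u u <= \sum_i inner (a i) u ^+ 2) ->
  (forall u, \sum_i inner (a i) u ^+ 2 <= b ^+ 2 * inner u u) ->
  forall u, (s * (1 - delta) - b * delta) ^+ 2 * inner u u <= \sum_i inner (a i) u ^+ 2.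
Proof.
move=> s0 b0 t0 hN hb u; set t := s * _ - _.
have /andP[delta0 delta1] := delta01.
have hN' v : v \in N -> s * enorm v <= enorm (analysis v).
  move=> /hN h; rewrite -(@ler_pXn2r _ 2)// ?nnegrE ?mulr_ge0 ?enorm_ge0//.
  by rewrite enorm_analysis_sqr exprMn enorm_sqr.
have hb' v : enorm (analysis v) <= b * enorm v.
  rewrite -(@ler_pXn2r _ 2)// ?nnegrE ?mulr_ge0 ?enorm_ge0//.
  by rewrite enorm_analysis_sqr exprMn enorm_sqr.
have key v : inner v v = 1 -> t <= enorm (analysis v).
  move=> v1; have [v' [v'N _ vv']] := netN v1.
  have ev : enorm v = 1 by rewrite enormE v1 sqrtr1.
  have h1 : enorm v <= enorm v' + enorm (v - v').
    by apply: le_trans _ (enorm_triangle _ _); rewrite addrC subrK.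
  have h2 : enorm (analysis v') <= enorm (analysis v) + enorm (analysis (v' - v)).
    by apply: le_trans _ (enorm_triangle _ _); rewrite -analysisD addrC subrK.
  have h3 := hb' (v' - v); rewrite -(opprB v v') enormN in h3.
  have h4 := hN' _ v'N.
  have h5 := ler_wpM2l b0 vv'.
  have h6 : 1 - delta <= enorm v' by lra.
  have h7 := ler_wpM2l s0 h6.
  rewrite /t -(opprB v v') in h2 *; lra.
have [->|u0] := eqVneq u 0.
  rewrite -(scale0r (0 : 'cV_d)) innerZl mul0r mulr0.
  by apply: sumr_ge0 => i _; exact: sqr_ge0.
have eu : 0 < enorm u by rewrite lt_neqAle eq_sym enorm_eq0 u0 enorm_ge0.
have := key ((enorm u)^-1 *: u).
rewrite innerZl innerZr mulrA -expr2 -enorm_sqr -exprMn mulVf ?gt_eqF// expr1n.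
move=> /(_ erefl); rewrite analysisZ enormZ ?invr_ge0 ?(ltW eu)// mulrC ler_pdivlMr// => h.
rewrite -exprMn -enorm_analysis_sqr ler_pXn2r ?nnegrE ?enorm_ge0//.
by rewrite mulr_ge0// enorm_ge0.
Qed.

End net_frames.

(** * Numerical estimates *)

Lemma ffact_le_expn n k : (n ^_ k <= n ^ k)%N.
Proof.
elim: k => [|k IH]; first by rewrite ffactn0.
by rewrite ffactnSr expnSr leq_mul// leq_subr.
Qed.

Section numerics.
Context {R : realType}.

Lemma le2_expR : 2 <= expR (3 / 4) :> R.
Proof.
rewrite -(@ler_pXn2r _ 4)// ?nnegrE ?expR_ge0// -expRM_natl.
have -> : 4%:R * (3 / 4) = 3%:R * 1 :> R by field.
rewrite expRM_natl; have := @expR1_ge R => h.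
apply: (@le_trans _ _ ((51 / 20) ^+ 3)); first by lra.
by rewrite ler_pXn2r ?nnegrE ?expR_ge0//; lra.
Qed.

Lemma le10_expR : 10 <= expR (5 / 2) :> R.
Proof.
rewrite -(@ler_pXn2r _ 2)// ?nnegrE ?expR_ge0// -expRM_natl.
have -> : 2%:R * (5 / 2) = 5%:R * 1 :> R by field.
rewrite expRM_natl.
have h := @expR1_ge R.
apply: (@le_trans _ _ ((51 / 20) ^+ 5)); first by lra.
by rewrite ler_pXn2r ?nnegrE ?expR_ge0//; lra.
Qed.

Lemma expR_le4 : expR (5 / 4) <= 4 :> R.
Proof.
rewrite -(@ler_pXn2r _ 4)// ?nnegrE ?expR_ge0// -expRM_natl.
have -> : 4%:R * (5 / 4) = 5%:R * 1 :> R by field.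
rewrite expRM_natl; have := @expR1_le R => h.
apply: (@le_trans _ _ (3 ^+ 5)); last by lra.
by rewrite ler_pXn2r ?nnegrE ?expR_ge0.
Qed.

(** ['C(n, k) <= n^k / k! <= c^k k^k / k!], and [k^k / k!] is a term of the series of [expR k]. *)
Lemma bin_le_expR (n k c : nat) : (0 < k)%N -> (n <= c * k)%N ->
  'C(n, k)%:R <= (expR 1 * c%:R) ^+ k :> R.
Proof.
move=> k0 nck.
have f0 : 0 < k`!%:R :> R by rewrite ltr0n fact_gt0.
rewrite -(ler_pM2r f0) -natrM bin_ffact.
apply: (@le_trans _ _ ((c%:R * k%:R) ^+ k)).
  rewrite -natrM -natrX ler_nat.
  by apply: leq_trans (ffact_le_expn _ _) _; rewrite leq_exp2r.
rewrite !exprMn -mulrA mulrCA ler_wpM2l ?exprn_ge0//.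
have := @expR_ge1Dxn R k%:R k.-1 (ler0n _ _); rewrite prednK// => h.
rewrite -expRM_natl mulr1 -ler_pdivrMr//.
by apply: le_trans h; rewrite lerDr.
Qed.

(* The factors are the net size, the number of choices of group elements, and the
   Chernoff bound. *)
Lemma upper_failure_le (x L : R) (n d m : nat) : 0 < x < 1 -> (0 < m)%N ->
  L = 1 + ln m%:R -> d%:R <= x ^+ 2 * n%:R ->
  (expR 2 / (1 / 10)) ^+ d *
    (m%:R ^+ n * (2 * expR (- (3 / 8) * (81 / 25 * expR (3 * x) * L))) ^+ n)
  <= expR (- (d%:R / x)).
Proof.
move=> /andP[x0 x1] m0 LE dn.
have m1 : 1 <= m%:R :> R by rewrite ler1n.
have mE : m%:R = expR (L - 1) by rewrite LE addrAC subrr add0r lnK// posrE ltr0n.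
have L1 : 1 <= L by rewrite LE lerDl ln_ge0.
set t := 81 / 25 * _ * L.
have e1 : expR 2 / (1 / 10) <= expR (9 / 2) :> R.
  have -> : 9 / 2 = 2 + 5 / 2 :> R by field.
  by rewrite (expRD 2) ler_pM2l ?expR_gt0// div1r invrK le10_expR.
have e2 : m%:R * (2 * expR (- (3 / 8) * t)) <= expR (L - 1 + (3 / 4 + - (3 / 8) * t)).
  rewrite mE (expRD (L - 1)) ler_pM2l ?expR_gt0// (expRD (3 / 4)).
  by rewrite ler_pM2r ?expR_gt0// le2_expR.
rewrite -exprMn.
apply: (@le_trans _ _ (expR (9 / 2) ^+ d * expR (L - 1 + (3 / 4 + - (3 / 8) * t)) ^+ n)).
  apply: ler_pM; rewrite ?exprn_ge0 ?divr_ge0 ?mulr_ge0 ?expR_ge0//.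
    by apply: lerXn2r; rewrite ?nnegrE ?divr_ge0 ?expR_ge0.
  by apply: lerXn2r; rewrite ?nnegrE ?mulr_ge0 ?expR_ge0.
rewrite -!expRM_natl -expRD ler_expR.
have ex : 1 + 3 * x + 9 / 4 * x ^+ 2 <= expR (3 * x).
  have -> : 3 * x = 2%:R * (3 / 2 * x) by field.
  rewrite expRM_natl; have h := expR_ge1Dx (3 / 2 * x).
  apply: (@le_trans _ _ ((1 + 3 / 2 * x) ^+ 2)).
    by rewrite le_eqVlt; apply/orP; left; apply/eqP; field.
  by rewrite ler_pXn2r// ?nnegrE ?expR_ge0//; lra.
set s := 243 / 200 * expR (3 * x).
have tE : 3 / 8 * t = s * L by rewrite /t /s; field.
(* Per index the gain [s - 3/4] pays for the net, [9/2 d <= 9/2 x^2 n], and for the target,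
   [d / x <= x n]. *)
have s1 : x + 9 / 2 * x ^+ 2 <= s - 3 / 4.
  have : x ^+ 2 <= x by rewrite expr2 ler_piMr// ltW.
  rewrite /s; lra.
have s2 : 0 <= s - 3 / 4 by apply: le_trans s1; rewrite addr_ge0 ?mulr_ge0 ?sqr_ge0 ?ltW.
have sge1 : 1 <= s.
  by rewrite /s; have := sqr_ge0 x; lra.
(* Since [s >= 1], the term [s L] absorbs [ln m = L - 1], the cost of choosing group elements. This
   is the reason for the factor [L] in the threshold. *)
have neg : L - 1 + (3 / 4 + - (3 / 8) * t) <= - (s - 3 / 4).
  by rewrite mulNr tE; nra.
have n0 : 0 <= n%:R :> R by [].
have h1 := ler_wpM2l n0 neg.
have h2 := ler_wpM2l n0 s1.
have dx : d%:R / x <= x * n%:R by rewrite ler_pdivrMr// mulrAC -expr2.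
rewrite -lerBrDl; apply: le_trans h1 _.
by lra.
Qed.

(** Here [expR (p * l)] is the claimed distortion. The net costs [x^2 (11/4 + p l)] per index, so
    [p (1 - x^2) l] must dominate [l + 3/2 x + x + 11/4 x^2]; the surplus [2 x l] covers the last
    three terms because [l >= 11/4]. *)
Lemma lower_failure_le (x p l : R) (k d : nat) : 0 < x < 1 ->
  1 + 2 * x <= p * (1 - x ^+ 2) -> 11 / 4 <= l -> d%:R <= x ^+ 2 * k%:R ->
  (expR 2 / (2 * expR (p * l))^-1) ^+ d * expR (l + 3 / 2 * x - p * l) ^+ k
  <= expR (- (d%:R / x)).
Proof.
move=> /andP[x0 x1] hp hl dk.
have x20 : 0 <= x ^+ 2 by exact: sqr_ge0.
have p1 : 1 + 2 * x <= p.
  have x21 : x ^+ 2 < 1 by rewrite expr_lt1// ltW.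
  have p0 : 0 <= p by rewrite leNgt; apply/negP => pn; nra.
  nra.
have e1 : expR 2 / (2 * expR (p * l))^-1 <= expR (11 / 4 + p * l).
  have -> : 11 / 4 + p * l = 2 + (3 / 4 + p * l) by field.
  by rewrite invrK (expRD 2) (expRD (3 / 4)) ler_pM2l ?expR_gt0// ler_pM2r ?expR_gt0// le2_expR.
apply: (@le_trans _ _ (expR (11 / 4 + p * l) ^+ d * expR (l + 3 / 2 * x - p * l) ^+ k)).
  apply: ler_wpM2r; first by rewrite exprn_ge0 ?expR_ge0.
  by apply: lerXn2r; rewrite ?nnegrE ?expR_ge0// invrK !mulr_ge0 ?expR_ge0.
rewrite -!expRM_natl -expRD ler_expR.
set e := l + 3 / 2 * x - p * l.
have l0 : 0 <= l by lra.
have main : x ^+ 2 * (11 / 4 + p * l) + e + x <= 0.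
  have h := ler_wpM2r l0 hp.
  have : x ^+ 2 <= x by rewrite expr2 ler_piMr// ltW.
  rewrite /e; nra.
have a0 : 0 <= 11 / 4 + p * l by nra.
have k0 : 0 <= k%:R :> R by [].
have h1 := ler_wpM2r a0 dk.
have h2 := ler_wpM2l k0 main.
have dx : d%:R / x <= x * k%:R by rewrite ler_pdivrMr// mulrAC -expr2.
nra.
Qed.

(** Origin of [c]: with [x = 1 / y], [(1 + 2 x) / (1 - x^2) = 1 + (2 + (y + 2) / (y^2 - 1)) x], and
    the inner fraction decreases in [y > 1], so its value at [y0] serves for all larger [y]. *)
Lemma exponent_ge (y0 y : R) : 1 < y0 -> y0 <= y ->
  1 + 2 * y^-1 <= (1 + (2 + (y0 + 2) / (y0 ^+ 2 - 1)) * y^-1) * (1 - y^-1 ^+ 2).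
Proof.
move=> h0 h.
have y1 : 1 < y by exact: lt_le_trans h.
have D0 : 0 < y0 ^+ 2 - 1 by nra.
have D : 0 < y ^+ 2 - 1 by nra.
have mono : (y + 2) / (y ^+ 2 - 1) <= (y0 + 2) / (y0 ^+ 2 - 1).
  rewrite ler_pdivrMr// mulrAC ler_pdivlMr// -subr_ge0.
  have -> : (y0 + 2) * (y ^+ 2 - 1) - (y + 2) * (y0 ^+ 2 - 1) =
    (y - y0) * (y * y0 + 1 + 2 * (y + y0)) by ring.
  by rewrite mulr_ge0// ?subr_ge0//; nra.
have yV : 0 < y^-1 by rewrite invr_gt0 (lt_trans _ y1).
have q : 0 <= 1 - y^-1 ^+ 2 by rewrite subr_ge0 expr_le1// ?ltW// invf_lt1// (lt_trans _ y1).
apply: (@le_trans _ _ ((1 + (2 + (y + 2) / (y ^+ 2 - 1)) * y^-1) * (1 - y^-1 ^+ 2))).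
  rewrite le_eqVlt; apply/orP; left; apply/eqP.
  have yn0 : y != 0 by rewrite gt_eqF// (lt_trans _ y1).
  have Dn0 : y ^+ 2 - 1 != 0 by rewrite gt_eqF.
  by field; rewrite yn0.
apply: ler_wpM2r => //; rewrite lerD2l; apply: ler_wpM2r; first exact: ltW.
by rewrite lerD2l.
Qed.

End numerics.

(** * Probability of the frame bounds *)

Lemma measurable_set_lt (R : realType) (dT : measure_display) (T : measurableType dT)
    (f g : T -> R) : measurable_fun setT f -> measurable_fun setT g ->
  measurable [set w | f w < g w].
Proof.
move=> mf mg; rewrite (_ : [set _ | _] = ~` [set w | g w <= f w]).
  by apply: measurableC; rewrite -[X in measurable X]setTI; exact: measurable_fun_le.
by apply/seteqP; split => w /=; rewrite ltNge => /negP.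
Qed.

Section union_bound.
Context {R : realType} {dT : measure_display} {T : measurableType dT}.
Variable P : probability T R.

Lemma seq_union_bound (J : eqType) (s : seq J) (A : J -> set T) (c : R) :
  (forall j, j \in s -> measurable (A j) /\ (P (A j) <= c%:E)%E) ->
  measurable (\big[setU/set0]_(j <- s) A j) /\
  (P (\big[setU/set0]_(j <- s) A j) <= ((size s)%:R * c)%:E)%E.
Proof.
elim: s => [|j s IH] h; first by rewrite big_nil measure0 mul0r; split.
have [mj Pj] := h j (mem_head _ _).
have [|ms Ps] := IH; first by move=> i si; apply: h; rewrite inE si orbT.
rewrite big_cons; split; first exact: measurableU.
apply: le_trans (measureU2 P mj ms) _.
by rewrite /= -natr1 addrC mulrDl mul1r EFinD leeD.
Qed.

Lemma notin_seq_union (J : eqType) (s : seq J) (A : J -> set T) w j :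
  ~ (\big[setU/set0]_(j <- s) A j) w -> j \in s -> ~ A j w.
Proof.
move=> h js Aj; apply: h; elim: s js => // i s IH.
by rewrite inE big_cons => /orP[/eqP <-|/IH]; [left|right].
Qed.

End union_bound.

Section frame_events.
Context {R : realType} {dT : measure_display} {T : measurableType dT}.
Variable P : probability T R.
Variables (n d : nat) (Z : 'I_n -> 'I_d -> {RV P >-> R}).
Hypothesis gZ : forall i j, std_gaussian (Z i j).
Hypothesis indZ : mutually_independent Z.
Variable G : seq 'M[R]_d.
Hypothesis hG : is_fin_orth_group G.

Definition templates (w : T) (i : 'I_n) : 'cV[R]_d := \col_j Z i j w.

Lemma inner_templates (g : 'M[R]_d) (u : 'cV[R]_d) i w :
  inner (g *m templates w i) u = \sum_(j < d) (g^T *m u) j 0 * Z i j w.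
Proof. by rewrite inner_mulmxl innerC; apply: eq_bigr => j _; rewrite [X in _ * X]mxE. Qed.

Lemma inner_templates_unit (u : 'cV[R]_d) (g : 'I_n -> 'M[R]_d) : u != 0 -> (forall i, g i \in G) ->
  exists2 v : 'I_n -> 'I_d -> R, (forall i, \sum_(j < d) v i j ^+ 2 = 1) &
  forall w i, inner (g i *m templates w i) u ^+ 2 =
    inner u u * (\sum_(j < d) v i j * Z i j w) ^+ 2.
Proof.
move=> u0 gG; have en0 : enorm u != 0 by rewrite enorm_eq0.
exists (fun i j => (enorm u)^-1 * ((g i)^T *m u) j 0) => [i|w i].
  under eq_bigr do rewrite exprMn.
  rewrite -mulr_sumr.
  have -> : \sum_j ((g i)^T *m u) j 0 ^+ 2 = enorm u ^+ 2.
    rewrite -(enorm_group hG u (group_trmx hG (gG i))) enorm_sqr.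
    by apply: eq_bigr => j _; rewrite expr2.
  by rewrite exprVn mulVf// expf_neq0.
rewrite inner_templates -enorm_sqr -exprMn mulr_sumr; congr (_ ^+ 2).
by apply: eq_bigr => j _; rewrite !mulrA divff// mul1r.
Qed.

Lemma measurable_sum_inner (u : 'cV[R]_d) (g : 'I_n -> 'M[R]_d) (I : {set 'I_n}) :
  measurable_fun setT (fun w => \sum_(i in I) inner (g i *m templates w i) u ^+ 2).
Proof.
under eq_fun do under eq_bigr do rewrite inner_templates.
exact: (measurable_sum_sqr Z (fun i j => ((g i)^T *m u) j 0) I).
Qed.

Lemma template_lower_tail (u : 'cV[R]_d) (g : 'I_n -> 'M[R]_d) (I : {set 'I_n}) (s : R) :
  (forall i, g i \in G) -> 0 < s <= 1 ->
  let A := [set w | \sum_(i in I) inner (g i *m templates w i) u ^+ 2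
                    < s ^+ 2 * #|I|%:R * inner u u] in
  measurable A /\ (P A <= ((expR (1 / 2) * s) ^+ #|I|)%:E)%E.
Proof.
move=> gG s01 A; have mA : measurable A.
  by apply: measurable_set_lt => //; exact: measurable_sum_inner.
split => //; have /andP[s0 _] := s01.
(* A net may contain 0; the strict inequality makes the event empty there. *)
have [u0|u0] := eqVneq u 0.
  have -> : A = set0.
    apply/seteqP; split => w //=; rewrite /A /= u0 (_ : inner 0 0 = 0); last first.
      by apply/eqP; rewrite inner_eq0.
    by rewrite mulr0 ltNge sumr_ge0// => i _; exact: sqr_ge0.
  by rewrite measure0 lee_fin exprn_ge0// mulr_ge0 ?expR_ge0 ?ltW.
have [v v1 vE] := inner_templates_unit u0 gG.
apply: le_trans (sum_sqr_lower_tail gZ indZ I v1 s01).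
have u2 : 0 < inner u u by rewrite lt_neqAle eq_sym inner_eq0 u0 inner_ge0.
apply: le_measure; rewrite ?inE//.
  rewrite -[X in measurable X]setTI.
  by apply: measurable_fun_le => //; exact: measurable_sum_sqr.
move=> w; rewrite /A /=; under eq_bigr do rewrite vE.
by rewrite -mulr_sumr [ltRHS]mulrC ltr_pM2l// => /ltW.
Qed.

Lemma template_upper_tail (u : 'cV[R]_d) (g : 'I_n -> 'M[R]_d) (t : R) :
  (forall i, g i \in G) ->
  let A := [set w | t * n%:R * inner u u < \sum_i inner (g i *m templates w i) u ^+ 2] in
  measurable A /\ (P A <= ((2 * expR (- (3 / 8) * t)) ^+ n)%:E)%E.
Proof.
move=> gG A; have mA : measurable A.
  apply: measurable_set_lt => //.
  have := measurable_sum_inner u g [set: 'I_n]%SET.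
  by under eq_fun do under eq_bigl do rewrite inE.
split => //.
have [u0|u0] := eqVneq u 0.
  have i0 (q : 'cV[R]_d) : inner q 0 = 0.
    by rewrite -[X in inner _ X](scale0r 0) innerZr mul0r.
  have -> : A = set0.
    apply/seteqP; split => w //=; rewrite /A /= u0 i0 mulr0 big1 ?ltxx// => i _.
    by rewrite i0 expr0n.
  by rewrite measure0 lee_fin exprn_ge0// mulr_ge0 ?expR_ge0.
have [v v1 vE] := inner_templates_unit u0 gG.
apply: le_trans (sum_sqr_upper_tail gZ indZ t v1).
have u2 : 0 < inner u u by rewrite lt_neqAle eq_sym inner_eq0 u0 inner_ge0.
apply: le_measure; rewrite ?inE//.
  rewrite -[X in measurable X]setTI.
  apply: measurable_fun_le => //.
  have := measurable_sum_sqr Z v [set: 'I_n]%SET.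
  by under eq_fun do under eq_bigl do rewrite inE.
move=> w; rewrite /A /=; under eq_bigr do rewrite vE.
by rewrite -mulr_sumr [ltLHS]mulrC ltr_pM2l// => /ltW.
Qed.

(** Choices of one group element per template are encoded by a finite type, over which a union bound
    can run. *)
Definition select (f : {ffun 'I_n -> 'I_(size G)}) (i : 'I_n) : 'M[R]_d := nth 0 G (f i).

Lemma select_in f i : select f i \in G.
Proof. exact: mem_nth. Qed.

Lemma selectP (g : 'I_n -> 'M[R]_d) : (forall i, g i \in G) ->
  exists f, forall i, g i = select f i.
Proof.
move=> gG.
have ig i : (index (g i) G < size G)%N by rewrite index_mem.
exists [ffun i => Ordinal (ig i)] => i.
by rewrite /select ffunE /= nth_index.
Qed.

Lemma frame_upper_event (N : seq 'cV[R]_d) (delta t : R) : 0 < delta < 1 -> 0 <= t ->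
  (forall u : 'cV[R]_d, inner u u = 1 ->
    exists u', [/\ u' \in N, enorm u' <= 1 & enorm (u - u') <= delta]) ->
  exists A : set T, [/\ measurable A,
    (P A <= ((size N)%:R * ((size G)%:R ^+ n * (2 * expR (- (3 / 8) * t)) ^+ n))%:E)%E &
    forall w, ~ A w ->
      frame_upper G (templates w) (Num.sqrt (t * n%:R) / (1 - delta))].
Proof.
move=> delta01 t0 netN.
pose B u f := [set w | t * n%:R * inner u u <
  \sum_i inner (select f i *m templates w i) u ^+ 2].
pose A1 u := \big[setU/set0]_(f <- enum {ffun 'I_n -> 'I_(size G)}) B u f.
pose A := \big[setU/set0]_(u <- N) A1 u.
have h1 u : measurable (A1 u) /\
    (P (A1 u) <= ((size G)%:R ^+ n * (2 * expR (- (3 / 8) * t)) ^+ n)%:E)%E.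
  have := @seq_union_bound _ _ _ P _ (enum {ffun 'I_n -> 'I_(size G)}) (B u)
    ((2 * expR (- (3 / 8) * t)) ^+ n) (fun f _ => template_upper_tail u t (select_in f)).
  by rewrite -cardE card_ffun !card_ord natrX.
have [mA PA] := @seq_union_bound _ _ _ P _ N A1 _ (fun u _ => h1 u).
exists A; split => // w nA g gG u.
have [f fE] := selectP gG.
have c0 : 0 <= t * n%:R by rewrite mulr_ge0.
apply: (net_frame_upper (a := fun i => g i *m templates w i) delta01 netN);
  first exact: sqrtr_ge0.
move=> u' u'N; rewrite sqr_sqrtr//.
have := notin_seq_union (notin_seq_union nA u'N) (mem_enum _ f).
rewrite /B /= => /negP; rewrite -leNgt.
by under eq_bigr do rewrite -fE.
Qed.

Lemma frame_lower_event (N : seq 'cV[R]_d) (k : nat) (delta s b : R) :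
  0 < delta < 1 -> 0 < s <= 1 -> 0 <= b ->
  0 <= s * Num.sqrt k%:R * (1 - delta) - b * delta ->
  (forall u : 'cV[R]_d, inner u u = 1 ->
    exists u', [/\ u' \in N, enorm u' <= 1 & enorm (u - u') <= delta]) ->
  exists A : set T, [/\ measurable A,
    (P A <= ((size N)%:R * ('C(n, k)%:R *
              ((size G)%:R ^+ k * (expR (1 / 2) * s) ^+ k)))%:E)%E &
    forall w, ~ A w -> frame_upper G (templates w) b ->
      frame_lower G (templates w) k (s * Num.sqrt k%:R * (1 - delta) - b * delta)].
Proof.
move=> delta01 s01 b0 t0 netN; have /andP[s0 _] := s01.
have G0 : (0 < size G)%N by have := group1 hG; case: (G).
pose f0 : 'I_(size G) := Ordinal G0.
pose B u (I : {set 'I_n}) f := [set w |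
  \sum_(i in I) inner (select f i *m templates w i) u ^+ 2
     < s ^+ 2 * #|I|%:R * inner u u].
(* [pffun_on] freezes the choice outside [I] at [f0], so [size G ^ k] choices are counted instead of
   [size G ^ n]; this keeps the final base linear in [m] up to the logarithm. *)
pose A1 u (I : {set 'I_n}) := \big[setU/set0]_(f <- enum (pffun_on f0 (mem I) predT)) B u I f.
pose A2 u := \big[setU/set0]_(I <- enum [set I : {set 'I_n} | #|I| == k]%SET) A1 u I.
pose A := \big[setU/set0]_(u <- N) A2 u.
have h1 u I : I \in enum [set I : {set 'I_n} | #|I| == k]%SET -> measurable (A1 u I) /\
    (P (A1 u I) <= ((size G)%:R ^+ k * (expR (1 / 2) * s) ^+ k)%:E)%E.
  rewrite mem_enum inE => /eqP cI.
  have := @seq_union_bound _ _ _ P _ (enum (pffun_on f0 (mem I) predT)) (B u I)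
    ((expR (1 / 2) * s) ^+ #|I|) (fun f _ => template_lower_tail u I (select_in f) s01).
  by rewrite -cardE card_pffun_on card_ord natrX cI.
have h2 u : measurable (A2 u) /\
    (P (A2 u) <= ('C(n, k)%:R * ((size G)%:R ^+ k * (expR (1 / 2) * s) ^+ k))%:E)%E.
  have := @seq_union_bound _ _ _ P _ _ (A1 u) _ (h1 u).
  by rewrite -cardE card_draws card_ord.
have [mA PA] := @seq_union_bound _ _ _ P _ N A2 _ (fun u _ => h2 u).
exists A; split => // w nA ub I cI g gG u.
(* Zero rows outside [I] turn the subfamily into one indexed by all of ['I_n], as the net argument
   requires. *)
pose a i := if i \in I then g i *m templates w i else 0.
have i0 (q : 'cV[R]_d) : inner 0 q = 0.
  by rewrite -[X in inner X _](scale0r 0) innerZl mul0r.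
have aE v : \sum_i inner (a i) v ^+ 2 = \sum_(i in I) inner (g i *m templates w i) v ^+ 2.
  rewrite [RHS]big_mkcond; apply: eq_bigr => i _; rewrite /a; case: ifP => // _.
  by rewrite i0 expr0n.
have [f fE] := selectP gG.
rewrite -aE; apply: (net_frame_lower (a := a) delta01 netN) => //.
- by rewrite mulr_ge0 ?sqrtr_ge0 ?ltW.
- move=> u' u'N; rewrite aE exprMn sqr_sqrtr//.
  pose f' : {ffun 'I_n -> 'I_(size G)} := [ffun i => if i \in I then f i else f0].
  have f'in : f' \in enum (pffun_on f0 (mem I) predT).
    rewrite mem_enum; apply/pffun_onP; split.
      by apply/fintype.subsetP => i; rewrite inE /f' ffunE; case: ifP; rewrite ?eqxx.
    by move=> ? _.
  have Iin : I \in enum [set I : {set 'I_n} | #|I| == k]%SET by rewrite mem_enum inE cI.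
  have := notin_seq_union (notin_seq_union (notin_seq_union nA u'N) Iin) f'in.
  rewrite /B /= => /negP; rewrite -leNgt cI.
  rewrite (eq_bigr (fun i => inner (g i *m templates w i) u' ^+ 2))//.
  by move=> i iI; rewrite fE /select /f' ffunE iI.
- move=> v; apply: le_trans (ub g gG v); rewrite aE big_mkcond /=.
  by apply: ler_sum => i _; case: ifP => // _; exact: sqr_ge0.
Qed.

End frame_events.

Lemma frame_upper_mono (R : realType) (d n : nat) (G : seq 'M[R]_d)
    (z : 'I_n -> 'cV[R]_d) (a b : R) :
  0 <= a -> a <= b -> frame_upper G z a -> frame_upper G z b.
Proof.
move=> a0 ab ha g gG u; apply: le_trans (ha g gG u) _.
apply: ler_wpM2r; first exact: inner_ge0.
by apply: lerXn2r; rewrite ?nnegrE// (le_trans a0).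
Qed.

Theorem theorem32 (R : realType) (d : nat) (G : seq 'M[R]_d) (n : nat)
  (lambda0 : R) (dT : measure_display) (T : measurableType dT)
  (P : probability T R) (Z : 'I_n -> 'I_d -> {RV P >-> R}) :
  is_fin_orth_group G ->
  let m := size G in
  let chi := chiG G in
  let lambda := n%:R / (chi%:R * d%:R) in
  1 < lambda0 -> lambda0 <= lambda ->
  (forall i j, std_gaussian (Z i j)) ->
  mutually_independent Z ->
  let C := 4 * expR (3 / 2) in
  let c := 2 + (Num.sqrt lambda0 + 2) / (lambda0 - 1) in
  exists E : set T,
    [/\ measurable E,
        E `<=` [set w | (distortion G
                           (filter_bank G (fun i => \col_(j < d) Z i j w))
                         <= ((C * chi%:R `^ (3 / 2) * m%:R
                               * Num.sqrt (ln (expR 1 * m%:R)))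
                              `^ (1 + c * lambda `^ (- (1 / 2))))%:E)%E]
      & ((1 - 3 * expR (- (d%:R * Num.sqrt lambda)))%:E <= P E)%E].
Proof.
move=> hG m chi lambda l01 l0l gZ indZ C c.
have l1 : 1 < lambda by exact: lt_le_trans l0l.
have lam0 : 0 < lambda by exact: lt_trans l1.
(* Division by zero yields 0, so [lambda > 1] already forces [chi] and [d] to be positive. *)
have cd0 : 0 < chi%:R * d%:R :> R.
  rewrite lt_neqAle mulr_ge0 ?ler0n// andbT eq_sym; apply/negP => /eqP e.
  by move: lam0; rewrite /lambda e invr0 mulr0 ltxx.
have chi0 : (0 < chi)%N.
  by rewrite lt0n; apply/negP => /eqP e; move: cd0; rewrite e mul0r ltxx.
have d0 : (0 < d)%N.
  by rewrite lt0n; apply/negP => /eqP e; move: cd0; rewrite e mulr0 ltxx.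
have nE : n%:R = lambda * (chi%:R * d%:R) by rewrite /lambda divfK// gt_eqF.
have n0 : (0 < n)%N by rewrite -(ltr0n R) nE mulr_gt0.
have m0 : (0 < m)%N by rewrite /m; have := group1 hG; case: (G).
have chi1 : 1 <= chi%:R :> R by rewrite ler1n.
have m1 : 1 <= m%:R :> R by rewrite ler1n.
(* [k.+1] is the ceiling of [n / chi]: [chi * k < n] feeds the pigeonhole, [n <= chi * k.+1] the
   binomial bound. *)
pose k := (n.-1 %/ chi)%N.
have chik : (chi * k < n)%N.
  by rewrite mulnC -[X in (_ < X)%N](prednK n0) ltnS leq_trunc_div.
have nK : (n <= chi * k.+1)%N.
  by rewrite mulnC -[X in (X <= _)%N](prednK n0); exact: ltn_ceil.
pose y := Num.sqrt lambda; pose y0 := Num.sqrt lambda0.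
have y01 : 1 < y0 by rewrite /y0 -[ltLHS]sqrtr1 ltr_sqrt// (lt_trans _ l01).
have y0y : y0 <= y by exact: ler_wsqrtr.
have y1 : 1 < y by exact: lt_le_trans y0y.
have ygt0 : 0 < y by exact: lt_trans y1.
pose x := y^-1.
have x0 : 0 < x by rewrite invr_gt0.
have x1 : x < 1 by rewrite invf_lt1.
have x01 : 0 < x < 1 by rewrite x0.
have x2 : x ^+ 2 = lambda^-1 by rewrite exprVn sqr_sqrtr// ltW.
have dn : x ^+ 2 * n%:R = chi%:R * d%:R by rewrite x2 nE mulKf// gt_eqF.
have dxn : d%:R <= x ^+ 2 * n%:R by rewrite dn ler_peMl.
have dxk : d%:R <= x ^+ 2 * k.+1%:R.
  rewrite -(@ler_pM2l _ chi%:R) ?ltr0n// -dn mulrCA -natrM.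
  by apply: ler_wpM2l; [exact: sqr_ge0|rewrite ler_nat].
pose p := 1 + c * x.
have hp : 1 + 2 * x <= p * (1 - x ^+ 2).
  have := exponent_ge y01 y0y; rewrite [y0 ^+ 2]sqr_sqrtr//.
  by rewrite ltW// (lt_trans _ l01).
have p1 : 1 + 2 * x <= p.
  have x21 : x ^+ 2 < 1 by rewrite expr_lt1// ltW.
  have xx0 := sqr_ge0 x.
  have p0 : 0 <= p by rewrite leNgt; apply/negP => pn; nra.
  nra.
pose L := 1 + ln m%:R : R.
have L1 : 1 <= L by rewrite lerDl ln_ge0.
have L0 : 0 < L by exact: lt_le_trans L1.
have LE : ln (expR 1 * m%:R) = L by rewrite lnM ?posrE ?expR_gt0 ?ltr0n// expRK.
have sL1 : 1 <= Num.sqrt L by rewrite -[leLHS]sqrtr1 ler_wsqrtr.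
have sc1 : 1 <= Num.sqrt chi%:R :> R by rewrite -[leLHS]sqrtr1 ler_wsqrtr.
pose B := 4 * expR (3 / 2) * (chi%:R * Num.sqrt chi%:R) * m%:R * Num.sqrt L.
have BE : C * chi%:R `^ (3 / 2) * m%:R * Num.sqrt (ln (expR 1 * m%:R)) = B.
  rewrite LE /B /C; congr (_ * _ * _ * _).
  have -> : 3 / 2 = 1 + 2^-1 :> R by field.
  rewrite powRD; last by rewrite (gt_eqF (_ : 0 < chi%:R)) ?ltr0n ?implybT.
  by rewrite powRr1// powR12_sqrt.
have B1 : 4 * expR (3 / 2) <= B.
  have e0 : 0 <= 4 * expR (3 / 2) :> R by rewrite mulr_ge0// expR_ge0.
  have h1 : 1 <= chi%:R * Num.sqrt chi%:R :> R by rewrite -[leLHS]mulr1 ler_pM.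
  have h2 : 1 <= chi%:R * Num.sqrt chi%:R * m%:R :> R by rewrite -[leLHS]mulr1 ler_pM.
  have h3 : 1 <= chi%:R * Num.sqrt chi%:R * m%:R * Num.sqrt L by rewrite -[leLHS]mulr1 ler_pM.
  have -> : B = 4 * expR (3 / 2) * (chi%:R * Num.sqrt chi%:R * m%:R * Num.sqrt L).
    by rewrite /B; ring.
  exact: ler_peMr.
have B0 : 0 < B by apply: lt_le_trans B1; rewrite mulr_gt0// expR_gt0.
pose l := ln B.
have lE : B = expR l by rewrite /l lnK.
have hl : 11 / 4 <= l.
  rewrite -ler_expR -lE; apply: le_trans B1.
  have -> : 11 / 4 = 5 / 4 + 3 / 2 :> R by field.
  by rewrite expRD ler_pM2r ?expR_gt0// expR_le4.
have l0 : 0 <= l by lra.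
pose kappa := expR (p * l).
have kappaE : B `^ (1 + c * lambda `^ (- (1 / 2))) = kappa.
  rewrite /powR gt_eqF// /kappa /p; congr (expR ((_ + _ * _) * _)).
  by rewrite -/(powR _ _) powRN div1r powR12_sqrt// ltW.
have kappa0 : 0 < kappa by exact: expR_gt0.
have pl : l + 3 / 2 * x <= p * l by have := ler_wpM2r l0 p1; nra.
have kappa10 : 10 <= kappa.
  apply: le_trans le10_expR _; rewrite ler_expR; lra.
pose e := expR (3 / 2 * x).
have e0 : 0 < e by exact: expR_gt0.
(* [n] is replaced by its upper bound [chi * k.+1], so that the ratio to [sqrt k.+1] involves only
   [chi]; this is where [sqrt chi] enters. *)
pose b := 2 * e * Num.sqrt (chi%:R * k.+1%:R * L).
have b0 : 0 < b by rewrite !mulr_gt0// sqrtr_gt0 !mulr_gt0// ltr0n.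
(* Chosen so that [s * sqrt k.+1 = 2 b / kappa], twice the target, which leaves room for the loss
   from net to sphere. *)
pose s := 4 * e * (Num.sqrt chi%:R * Num.sqrt L) / kappa.
have s0 : 0 < s.
  by rewrite /s divr_gt0// !mulr_gt0// (lt_le_trans ltr01).
have sb : s * Num.sqrt k.+1%:R = 2 * b / kappa.
  rewrite /s /b sqrtrM ?mulr_ge0// sqrtrM//; field.
  by rewrite gt_eqF.
(* The base [B] is read off here: [e chi] from the binomial, [m] from the group choices, [e^(1/2)]
   from the lower tail, and [4 sqrt (chi L)] from [s], where 4 is the 2 in [b] times the safety
   factor 2. *)
have sB : expR 1 * chi%:R * (m%:R * (expR (1 / 2) * s)) = expR (l + 3 / 2 * x - p * l).
  rewrite expRB expRD -lE -/e -/kappa /s /B.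
  have -> : 3 / 2 = 1 + 1 / 2 :> R by field.
  by rewrite (expRD 1); field; rewrite gt_eqF.
have s1 : s <= 1.
  have h : expR 1 * chi%:R * (m%:R * (expR (1 / 2) * s)) <= 1.
    by rewrite sB -[leRHS]expR0 ler_expR subr_le0.
  apply: le_trans h; have -> : expR 1 * chi%:R * (m%:R * (expR (1 / 2) * s)) =
    (expR 1 * chi%:R * (m%:R * expR (1 / 2))) * s by ring.
  have g1 : 1 <= expR 1 :> R by rewrite -[leLHS]expR0 ler_expR.
  have g2 : 1 <= expR (1 / 2) :> R by rewrite -[leLHS]expR0 ler_expR.
  apply: ler_peMl; first exact: ltW.
  have h1 : 1 <= expR 1 * chi%:R :> R by rewrite -[leLHS]mulr1 ler_pM.
  have h2 : 1 <= m%:R * expR (1 / 2) :> R by rewrite -[leLHS]mulr1 ler_pM.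
  by rewrite -[leLHS]mulr1 ler_pM.
pose delta := (2 * kappa)^-1.
have delta0 : 0 < delta by rewrite invr_gt0 mulr_gt0.
have delta1 : delta <= 1 / 10.
  by rewrite /delta div1r lef_pV2 ?posrE ?mulr_gt0//; lra.
(* [81/25] is the square of [9/5], and the net of mesh [1/10] divides by [9/10], which gives the 2
   in [b]. *)
pose t := 81 / 25 * expR (3 * x) * L.
have t0 : 0 <= t by rewrite !mulr_ge0 ?expR_ge0// ltW.
pose q := expR (- (d%:R * y)).
have dq : expR (- (d%:R / x)) = q by rewrite /q /x invrK.
have [N1 sN1 netN1] := @exists_net R d (1 / 10) d0 ltac:(lra).
have [N2 sN2 netN2] := @exists_net R d delta d0 ltac:(by rewrite delta0).
have [A1 [mA1 PA1 hA1]] := @frame_upper_event _ _ _ P _ _ Z gZ indZ G hG N1 (1 / 10) t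
  ltac:(lra) t0 netN1.
pose a := s * Num.sqrt k.+1%:R * (1 - delta) - b * delta.
(* In units of [b / kappa], the net bound 2 loses [2 delta] and [1/2], and [delta <= 1/10]. *)
have ba : b / kappa <= a.
  have bk : 0 <= b / kappa by rewrite divr_ge0 ?ltW.
  have bd : b * delta = b / kappa / 2.
    by rewrite /delta invfM mulrA mulrAC.
  have sb2 : s * Num.sqrt k.+1%:R = 2 * (b / kappa) by rewrite sb mulrA.
  by rewrite /a bd sb2; nra.
have a0 : 0 < a by apply: lt_le_trans ba; rewrite divr_gt0.
have [A2 [mA2 PA2 hA2]] := @frame_lower_event _ _ _ P _ _ Z gZ indZ G hG N2 k.+1 delta s b
  ltac:(rewrite delta0/=; lra) ltac:(by rewrite s0) (ltW b0) (ltW a0) netN2.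
have PA1' : (P A1 <= q%:E)%E.
  apply: le_trans PA1 _; rewrite lee_fin -dq.
  apply: le_trans (upper_failure_le x01 m0 (erefl L) dxn).
  by apply: ler_wpM2r.
have PA2' : (P A2 <= q%:E)%E.
  apply: le_trans PA2 _; rewrite lee_fin -dq.
  apply: le_trans (lower_failure_le x01 hp hl dxk).
  have mk0 : 0 <= m%:R ^+ k.+1 * (expR (1 / 2) * s) ^+ k.+1.
    by rewrite mulr_ge0// exprn_ge0// mulr_ge0 ?expR_ge0// ltW.
  apply: ler_pM => //; first by rewrite mulr_ge0.
  apply: le_trans (ler_wpM2r mk0 (bin_le_expR (ltn0Sn k) nK)) _.
  by rewrite -!exprMn sB.
exists (~` (A1 `|` A2)); split.
- by apply: measurableC; exact: measurableU.
- move=> w /= nA.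
  have nA1 : ~ A1 w by move=> h; apply: nA; left.
  have nA2 : ~ A2 w by move=> h; apply: nA; right.
  have ub : frame_upper G (templates Z w) b.
    apply: frame_upper_mono (hA1 w nA1); first by rewrite divr_ge0 ?sqrtr_ge0//; lra.
    have tE : t * n%:R = (9 / 5 * e) ^+ 2 * (L * n%:R).
      have e3 : expR (3 * x) = e ^+ 2.
        by rewrite /e -expRM_natl; congr expR; field.
      by rewrite /t e3; field.
    rewrite tE sqrtrM ?sqr_ge0// sqrtr_sqr ger0_norm ?mulr_ge0 ?(ltW e0)//.
    have : Num.sqrt (L * n%:R) <= Num.sqrt (chi%:R * k.+1%:R * L).
      by rewrite ler_wsqrtr// mulrC ler_pM2r// -natrM ler_nat.
    move=> /(ler_wpM2l (ltW e0)) h; rewrite /b.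
    have -> : (1 - 1 / 10 : R) = 9 / 10 by field.
    have -> : 9 / 5 * e * Num.sqrt (L * n%:R) / (9 / 10) = 2 * (e * Num.sqrt (L * n%:R)) by field.
    by rewrite -mulrA ler_pM2l.
  have lb := hA2 w nA2 ub.
  have ulip := filter_bank_upper_lip hG (ltW b0) ub.
  have llip := filter_bank_lower_lip hG (ltW a0) (ltW b0) ub lb chik.
  rewrite BE kappaE; apply: le_trans (distortion_le a0 (ltW b0) llip ulip) _.
  by rewrite lee_fin ler_pdivrMr// mulrC -ler_pdivrMr.
- rewrite probability_setC; last exact: measurableU.
  (* Two failure events of probability at most [q] each; their total [2 q] is within the allowed
     [3 q]. *)
  have PU : (P (A1 `|` A2) <= (q + q)%:E)%E.
    by apply: le_trans (measureU2 P mA1 mA2) _; rewrite EFinD leeD.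
  have q0 : 0 <= q by exact: expR_ge0.
  rewrite -/y -/q EFinB leeB// (le_trans PU)// lee_fin; lra.
Qed.
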